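(* Let the delay differential algebraic system $$E\dot{\mathbf x}(t)=\sum_{k=0}^m A_k\mathbf x(t-\tau_k)+B\mathbf v(t),\qquad \mathbf z(t)=C\mathbf x(t)$$ be strongly exponentially stable. Then its spline-based Lanczos tau discretization with knots at the delays and Legendre basis on each segment preserves stability for $N$ sufficiently large: there is $N_0$ such that for all $N\ge N_0$, every $\lambda\in\mathbb C$ for which $\lambda\mathcal E_N^{\rm spl}-\mathcal A_N^{\rm spl}$ is not invertible satisfies $\operatorname{Re}\lambda<0$.
   Context: **System.** $E,A_0,\dots,A_m\in\mathbb C^{n\times n}$, $B\in\mathbb C^{n\times p}$, $C\in\mathbb C^{q\times n}$; $E$ may be singular; $0=\tau_0<\tau_1<\dots<\tau_m<\infty$, $\boldsymbol\tau=(\tau_1,\dots,\tau_m)$. Standing assumption (differentiation index at most one, semi-explicit system): if the columns of $\hat V$ form a basis of $\ker E$ and the columns of $\hat U^*$ form a basis of $\ker E^*$, then $\hat U A_0\hat V$ is nonsingular. **Strong exponential stability.** The spectral abscissa $\alpha(\boldsymbol\theta)$, $\boldsymbol\theta\in\mathbb R_+^m$, is the supremum of the real parts of the zeros of $\det\big(sE-A_0-\sum_{k=1}^mA_ke^{-\theta_ks}\big)$. The system is strongly exponentially stable if there is $\delta>0$ with $\sup\{\alpha(\boldsymbol\theta):\boldsymbol\theta\in\mathbb R_+^m,\ \|\boldsymbol\theta-\boldsymbol\tau\|<\delta\}<0$. **Spline discretization.** For $k=1,\dots,m$ and $N\ge1$ let $\mathbb P_{N}^{(k)}$ be the space of polynomials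 of degree at most $N$ from $[-\tau_k,-\tau_{k-1}]$ to $\mathbb C^n$, and let $\mathbb S_N=\prod_{k=1}^m\mathbb P_N^{(k)}$, with elements $\Xi=(\xi^{(1)},\dots,\xi^{(m)})$. Write $\varepsilon^{(k)}_\theta\Xi=\xi^{(k)}(\theta)$ and $\mathcal D^{(k)}\Xi=(\xi^{(k)})'$. Let $\varphi_N^{(k)}$ be the degree-$N$ Legendre polynomial shifted and scaled to $[-\tau_k,-\tau_{k-1}]$, and let $\mathcal T^{(k)}_{N-1}\Xi\in\mathbb P^{(k)}_{N-1}$ be $\xi^{(k)}$ with its component along $\varphi_N^{(k)}$ removed, componentwise $(\xi^{(k)})_j-\langle(\xi^{(k)})_j,\varphi^{(k)}_N\rangle\varphi_N^{(k)}/\|\varphi^{(k)}_N\|^2$ in the $L^2$ inner product on $[-\tau_k,-\tau_{k-1}]$. Define linear maps $\mathcal E_N^{\rm spl},\mathcal A_N^{\rm spl}:\mathbb S_N\to\mathbb C^n\times\prod_{k=1}^m\mathbb P^{(k)}_{N-1}\times(\mathbb C^n)^{m-1}$ (spaces of equal dimension) by $$\mathcal E_N^{\rm spl}\Xi=\Big(E\varepsilon_0^{(1)}\Xi,\ \big(\mathcal T_{N-1}^{(k)}\Xi\big)_{k=1}^m,\ (\mathbf 0)_{k=1}^{m-1}\Big),$$ $$\mathcal A_N^{\rm spl}\Xi=\Big(A_0\varepsilon_0^{(1)}\Xi+\sum_{k=1}^mA_k\varepsilon^{(k)}_{-\tau_k}\Xi,\ \big(\mathcal D^{(k)}\Xi\big)_{k=1}^m,\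 \big(\varepsilon^{(k)}_{-\tau_k}\Xi-\varepsilon^{(k+1)}_{-\tau_k}\Xi\big)_{k=1}^{m-1}\Big).$$ The discretization is $\mathcal E_N^{\rm spl}\dot\Xi_{tN}=\mathcal A_N^{\rm spl}\Xi_{tN}+(B,\mathbf 0,\mathbf 0)\mathbf v(t)$, $\mathbf z_N(t)=C\varepsilon_0^{(1)}\Xi_{tN}$. *)

(* Defs.v *)
From HB Require Import structures.
From mathcomp Require Import all_boot all_order all_algebra.
From mathcomp Require Import qpoly spectral sesquilinear.
From mathcomp Require Import all_classical all_reals all_analysis.
From mathcomp Require Import complex polyrcf ring.
Set Implicit Arguments.
Unset Strict Implicit.
Unset Printing Implicit Defensive.
Import Order.TTheory GRing.Theory Num.Theory.
Import numFieldNormedType.Exports.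
Local Open Scope classical_set_scope.
Local Open Scope sesquilinear_scope.
Local Open Scope complex_scope.
Local Open Scope ring_scope.

Definition cexp {R : realType} (z : R[i]) : R[i] :=
  (expR (complex.Re z))%:C * (cos (complex.Im z) +i* sin (complex.Im z)).

(* There are m.+1 >= 1 delays; ddae_tau also carries tau_0 = 0. *)
Record ddae (R : realType) (n p q m : nat) := Ddae {
  ddae_E : 'M[R[i]]_n;
  ddae_A : 'I_m.+2 -> 'M[R[i]]_n;
  ddae_B : 'M[R[i]]_(n, p);
  ddae_C : 'M[R[i]]_(q, n);
  ddae_tau : 'I_m.+2 -> R;
  ddae_tau0 : ddae_tau ord0 = 0;
  ddae_tau_lt : forall i j : 'I_m.+2, (i < j)%N -> ddae_tau i < ddae_tau j
}.

(* The columns of V form a basis of {x | M x = 0}; transposes appear because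
   mxalgebra works with row spaces and row kernels. *)
Definition col_basis_ker {F : fieldType} (n r : nat) (M : 'M[F]_n)
    (V : 'M[F]_(n, r)) : Prop :=
  row_free V^T /\ (V^T == kermx M^T)%MS.

Definition semi_explicit {R : realType} {n p q m : nat}
    (S : ddae R n p q m) : Prop :=
  forall (r : nat) (V : 'M[R[i]]_(n, r)) (U : 'M[R[i]]_(r, n)),
    col_basis_ker (ddae_E S) V -> col_basis_ker (ddae_E S ^t*) (U ^t*) ->
    U *m ddae_A S ord0 *m V \in unitmx.

Section Stability.
Context {R : realType} {n p q m : nat} (S : ddae R n p q m).

Definition delays : 'rV[R]_m.+1 := \row_k ddae_tau S (lift ord0 k).

Definition char_mx (theta : 'rV[R]_m.+1) (s : R[i]) : 'M[R[i]]_n :=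
  s *: ddae_E S - ddae_A S ord0
  - \sum_(k < m.+1)
      cexp (- ((theta ord0 k)%:C * s)) *: ddae_A S (lift ord0 k).

Definition spectral_abscissa (theta : 'rV[R]_m.+1) : \bar R :=
  ereal_sup [set (complex.Re s)%:E | s in [set s | \det (char_mx theta s) = 0]].

Definition euclidean_norm (x : 'rV[R]_m.+1) : R :=
  Num.sqrt (\sum_(k < m.+1) x ord0 k ^+ 2).

Definition strongly_exponentially_stable : Prop :=
  exists2 delta : R, 0 < delta &
    (ereal_sup [set spectral_abscissa theta | theta in
       [set theta : 'rV[R]_m.+1 | (forall k, (0 <= theta ord0 k)%R) /\
                     (euclidean_norm (theta - delays) < delta)%R]] < 0)%E.

End Stability.

(* Rodrigues' formula. *)
Definition legendre (F : fieldType) (N : nat) : {poly F} :=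
  (2 ^ N * N`!)%:R^-1 *: (('X ^+ 2 - 1) ^+ N)^`(N).

Section LegendreTruncation.
Context {R : realType}.
Implicit Types (a b x : R) (P Q : {poly R[i]}).

(* The inner affine map sends a to -1 and b to 1. *)
Definition seg_legendre a b (N : nat) : {poly R[i]} :=
  map_poly (real_complex R)
    (legendre R N \Po ((2 / (b - a)) *: 'X - ((a + b) / (b - a))%:P)).

Definition cintegral (D : set R) (f : R -> R[i]) : R[i] :=
  (\int[lebesgue_measure]_(x in D) complex.Re (f x))
    +i* (\int[lebesgue_measure]_(x in D) complex.Im (f x)).

Definition L2dot a b (f g : R -> R[i]) : R[i] :=
  cintegral `[a, b] (fun x => f x * (g x)^*%R).

Definition on_reals P : R -> R[i] := fun x => P.[x%:C].

Definition legendre_trunc a b (N : nat) P : {poly R[i]} :=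
  let phi := seg_legendre a b N in
  P - (L2dot a b (on_reals P) (on_reals phi)
       / L2dot a b (on_reals phi) (on_reals phi)) *: phi.

Let rc : {rmorphism R -> R[i]} := real_complex R.

Let prim {F : fieldType} (P : {poly F}) : {poly F} :=
  \poly_(i < (size P).+1) (P`_i.-1 / i%:R).

Let primK (F : numFieldType) (P : {poly F}) : (prim P)^`() = P.
Proof.
apply/polyP => i; rewrite coef_deriv coef_poly ltnS /=.
case: ltnP => [_|si]; last by rewrite mul0rn nth_default.
by rewrite -[_ *+ i.+1]mulr_natr divfK // pnatr_eq0.
Qed.

Let on_realsE P x :
  on_reals P x = (map_poly (@complex.Re R) P).[x]
                   +i* (map_poly (@complex.Im R) P).[x].
Proof.
rewrite /on_reals.
elim/poly_ind: P => [|P c IH].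
  by rewrite !(raddf0 (map_poly _)) !horner0.
have E (f : {additive R[i] -> R}) : (forall z, f (z * x%:C) = f z * x) ->
    (map_poly f (P * 'X + c%:P)).[x] = (map_poly f P).[x] * x + f c.
  move=> fM; rewrite raddfD /= map_polyC hornerD hornerC; congr (_ + _).
  rewrite -hornerMX; congr (_.[x]); apply/polyP => i.
  by rewrite coef_map !coefMX; case: i => [|i] /=; rewrite ?raddf0 ?coef_map.
rewrite hornerMXaddC IH !E /=.
- by clear E; case: c => u v; simpc.
- by case=> u v; simpc.
- by case=> u v; simpc.
Qed.

Let J a b P : R[i] := cintegral `[a, b] (on_reals P).

Let Rintegral_deriv a b (p : {poly R}) : a < b ->
  \int[lebesgue_measure]_(x in `[a, b]) p^`().[x] = p.[b] - p.[a].
Proof.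
move=> ab; rewrite /Rintegral.
rewrite (@continuous_FTC2 R (horner p^`()) (horner p)) //.
- exact/continuous_subspaceT/continuous_horner.
- split; first by move=> x _; exact: derivable_horner.
  + exact/cvg_at_right_filter/continuous_horner.
  + exact/cvg_at_left_filter/continuous_horner.
- by move=> x _; rewrite derivE.
Qed.

Let map_deriv (f : {additive R[i] -> R}) P :
  map_poly f P^`() = (map_poly f P)^`().
Proof. by apply/polyP => i; rewrite !(coef_map, coef_deriv) raddfMn. Qed.

Let J_deriv a b P : a < b -> J a b P^`() = P.[b%:C] - P.[a%:C].
Proof.
move=> ab; rewrite /J /cintegral.
under eq_Rintegral do rewrite on_realsE /= map_deriv.
rewrite Rintegral_deriv //.
under eq_Rintegral do rewrite on_realsE /= map_deriv.
rewrite Rintegral_deriv //.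
by rewrite -[P.[b%:C]]/(on_reals P b) -[P.[a%:C]]/(on_reals P a) !on_realsE.
Qed.

Let J_lin a b (c : R[i]) P Q : a < b -> J a b (c *: P + Q) = c * J a b P + J a b Q.
Proof.
move=> ab; rewrite -[P]primK -[Q]primK -derivZ -derivD !J_deriv //.
by rewrite !(hornerD, hornerZ) mulrBr opprD addrACA.
Qed.

Let L2dotE a b P (f : {poly R}) :
  L2dot a b (on_reals P) (on_reals (map_poly rc f)) = J a b (P * map_poly rc f).
Proof.
rewrite /L2dot /J; congr cintegral; apply/funext => x; rewrite /on_reals hornerM.
have -> : (map_poly rc f).[x%:C] = f.[x]%:C by exact: horner_map.
by congr (_ * _); exact: conjc_real.
Qed.

Let root_derivn (c : R[i]) (N k : nat) (W : {poly R[i]}) : (k < N)%N ->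
  (W * ('X - c%:P) ^+ N)^`(k).[c] = 0.
Proof.
move=> kN; suff [Q ->] : exists Q, (W * ('X - c%:P) ^+ N)^`(k)
    = Q * ('X - c%:P) ^+ (N - k).
  by rewrite hornerM horner_exp hornerXsubC subrr expr0n subn_eq0 leqNgt kN mulr0.
elim: k kN => [|k IH] kN; first by exists W; rewrite subn0.
have [Q EQ] := IH (ltnW kN); rewrite derivnS EQ -(subnSK (ltnW kN)).
set j := (N - k.+1)%N.
exists (Q^`() * ('X - c%:P) + Q *+ j.+1).
rewrite derivM deriv_exp derivXsubC mul1r /= exprS; ring.
Qed.

Let lin a b : {poly R} := (2 / (b - a)) *: 'X - ((a + b) / (b - a))%:P.

Let lin_ends a b : a < b -> (lin a b).[a] = -1 /\ (lin a b).[b] = 1.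
Proof.
by move=> ab; split; rewrite /lin !hornerE; field; rewrite subr_eq0 gt_eqF.
Qed.

Let orth a b N P : a < b -> (size P <= N)%N ->
  J a b (P * map_poly rc ((('X ^+ 2 - 1) ^+ N)^`(N) \Po lin a b)) = 0.
Proof.
move=> ab.
set W : {poly R[i]} := ('X ^+ 2 - 1) ^+ N.
set L := map_poly rc (lin a b).
have -> : map_poly rc ((('X ^+ 2 - 1) ^+ N)^`(N) \Po lin a b) = W^`(N) \Po L.
  rewrite map_comp_poly -derivn_map; congr (_^`(N) \Po _).
  rewrite [LHS]rmorphXn /W; congr (_ ^+ _).
  by rewrite [LHS]rmorphB [X in _ - X]rmorph1; congr (_ - _); exact: map_polyXn.
have [La Lb] := lin_ends ab.
have LaC : L.[a%:C] = -1 by rewrite -[a%:C]/(rc a) horner_map La rmorphN1.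
have LbC : L.[b%:C] = 1 by rewrite -[b%:C]/(rc b) horner_map Lb rmorph1.
have WE : W = ('X + 1) ^+ N * ('X - 1%:P) ^+ N.
  by rewrite -exprMn /W; congr (_ ^+ _); rewrite polyC1; ring.
have WE' : W = ('X - 1) ^+ N * ('X - (-1)%:P) ^+ N.
  by rewrite -exprMn /W; congr (_ ^+ _); rewrite polyCN polyC1; ring.
have W1 k : (k < N)%N -> W^`(k).[1] = 0 by rewrite WE; exact: root_derivn.
have WN1 k : (k < N)%N -> W^`(k).[-1] = 0 by rewrite WE'; exact: root_derivn.
pose c := rc (2 / (b - a)).
have c0 : c != 0 by rewrite fmorph_eq0 mulf_neq0 ?invr_eq0 ?subr_eq0 ?gt_eqF.
have L' : L^`() = c%:P.
  rewrite /L deriv_map /lin derivB derivZ derivX derivC subr0 -mul_polyC mulr1.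
  by rewrite map_polyC.
suff H k : (k <= N)%N -> forall P, (size P <= k)%N ->
    J a b (P * (W^`(k) \Po L)) = 0 by exact: H.
elim: k => [|k IH] kN {}P sP.
  move: sP; rewrite leqn0 size_poly_eq0 => /eqP ->.
  by rewrite mul0r -(deriv0 _) J_deriv // !horner0 subrr.
have := J_deriv (P * (W^`(k) \Po L)) ab.
rewrite !hornerM !horner_comp LaC LbC W1 // WN1 // !mulr0 subrr.
rewrite derivM deriv_comp L' -derivnS mulrA [_ * c%:P]mulrC mul_polyC addrC.
rewrite J_lin // IH ?(ltnW kN) // ?addr0.
  by move/eqP; rewrite mulf_eq0 (negbTE c0) => /eqP.
case: (eqVneq P 0) => [->|P0]; first by rewrite deriv0 size_poly0.
by rewrite -ltnS (leq_trans (lt_size_deriv P0)).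
Qed.

Let J_sqr_neq0 a b (f : {poly R}) : a < b -> f != 0 ->
  J a b (map_poly rc f * map_poly rc f) != 0.
Proof.
move=> ab f0; apply/eqP; rewrite -rmorphM /=.
set g := f * f; pose G := prim g.
rewrite -[g]primK -/G -deriv_map J_deriv // -[a%:C]/(rc a) -[b%:C]/(rc b).
rewrite !horner_map -rmorphB => /eqP; rewrite fmorph_eq0 subr_eq0 => /eqP Gab.
have Gmon : {in `[a, b] &, {homo horner G : x y / x <= y}}.
  by apply: ler_hornerW => x _; rewrite primK hornerM -expr2 sqr_ge0.
have Gc x : x \in `[a, b] -> G.[x] = G.[a].
  move=> xab; have /andP[ax xb] : a <= x <= b by move: xab; rewrite in_itv.
  apply/eqP; rewrite eq_le -{1}Gab !Gmon //.
  - by rewrite in_itv /= lexx ltW.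
  - by rewrite in_itv /= lexx ltW.
have g0 : g != 0 by rewrite mulf_neq0.
pose H := G - G.[a]%:P.
have H0 : H != 0.
  apply: contraNneq g0 => H0; apply/eqP.
  by have := congr1 deriv H0; rewrite derivB derivC subr0 primK deriv0.
pose rs := [seq a + (b - a) / i.+1%:R | i <- iota 0 (size H)].
have : (size rs < size H)%N.
  apply: max_poly_roots => //.
  - apply/allP => _ /mapP[i _ ->]; rewrite rootE /H hornerD hornerN hornerC.
    rewrite Gc ?subrr // in_itv /= lerDl divr_ge0 ?subr_ge0 ?(ltW ab) //=.
    by rewrite -lerBrDl ler_pdivrMr ?ltr0n // ler_peMr ?subr_ge0 ?(ltW ab) // ler1n.
  - rewrite map_inj_uniq ?iota_uniq // => i j /addrI.
    move/(mulfI _); rewrite subr_eq0 gt_eqF // => /(_ isT) /invr_inj /eqP.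
    by rewrite eqr_nat eqSS => /eqP.
by rewrite size_map size_iota ltnn.
Qed.

Let size_seg_legendre a b N : a < b -> size (legendre R N \Po lin a b) = N.+1.
Proof.
move=> ab; rewrite size_comp_poly2; last first.
  rewrite /lin size_polyDl ?size_scale ?size_polyX ?mulf_neq0 //
          ?invr_eq0 ?subr_eq0 ?gt_eqF //.
  by rewrite size_polyN (leq_ltn_trans (size_polyC_leq1 _)).
rewrite /legendre size_scale ?invr_eq0 ?pnatr_eq0 ?muln_eq0 ?expn_eq0 -?lt0n ?fact_gt0 //.
have mW : ('X ^+ 2 - 1 : {poly R}) ^+ N \is monic.
  by apply: monic_exp; rewrite -['X^2]/('X^(2%N)) monicXnsubC.
have sW : size (('X ^+ 2 - 1 : {poly R}) ^+ N) = (N + N).+1.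
  rewrite -[LHS]prednK ?size_poly_gt0 ?monic_neq0 // size_exp.
  by rewrite -['X^2]/('X^(2%N)) -polyC1 size_XnsubC //= mul2n addnn.
apply/anti_leq/andP; split.
  apply/leq_sizeP => j Nj; rewrite coef_derivn nth_default ?mul0rn // sW.
  by rewrite -addnS leq_add2l.
rewrite ltnNge; apply/negP => /leq_sizeP/(_ N (leqnn _))/eqP.
rewrite coef_derivn; have -> : (N + N)%N = (size (('X ^+ 2 - 1 : {poly R}) ^+ N)).-1.
  by rewrite sW.
rewrite -lead_coefE (monicP mW) pnatr_eq0 sW /=.
by rewrite -leqn0 leqNgt ffact_gt0 leq_addr.
Qed.

Lemma legendre_trunc_size a b N P : a < b -> (size P <= N.+1)%N ->
  (size (legendre_trunc a b N P) <= N)%N.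
Proof.
move=> ab sP; rewrite /legendre_trunc /= /seg_legendre -/(lin a b).
set f := legendre R N \Po lin a b; set phi := map_poly _ f.
have sf : size f = N.+1 by exact: size_seg_legendre.
have sphi : size phi = N.+1 by rewrite /phi size_map_poly.
have f0 : f != 0 by rewrite -size_poly_eq0 sf.
have lphi : phi`_N != 0.
  by rewrite -[N]/(N.+1.-1) -sphi -lead_coefE lead_coef_eq0 -size_poly_eq0 sphi.
pose c := P`_N / phi`_N; pose Q := P - c *: phi.
have sQ : (size Q <= N)%N.
  apply/leq_sizeP => j; rewrite leq_eqVlt => /predU1P[<-|Nj].
    by rewrite coefB coefZ /c divfK // subrr.
  by rewrite coefB coefZ !nth_default ?sphi ?mulr0 ?subrr // (leq_trans sP).
have JQ : J a b (Q * phi) = 0.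
  have -> : Q * phi = (rc (2 ^ N * N`!)%:R^-1 *: Q) *
      map_poly rc ((('X ^+ 2 - 1) ^+ N)^`(N) \Po lin a b).
    by rewrite /phi /f /legendre comp_polyZ map_polyZ -scalerAr -scalerAl.
  by apply: orth => //; rewrite (leq_trans (size_scale_leq _ _)).
rewrite !L2dotE -/phi.
have -> : J a b (P * phi) = c * J a b (phi * phi).
  by rewrite -[P in LHS](subrK (c *: phi)) -/Q addrC mulrDl -scalerAl J_lin // JQ addr0.
by rewrite mulfK // J_sqr_neq0.
Qed.

End LegendreTruncation.

Definition spline (R : realType) (n m N : nat) : Type :=
  {ffun 'I_m.+1 -> {ffun 'I_n -> {poly_N.+1 R[i]}}}.

Definition spline_codom (R : realType) (n m N : nat) : Type :=
  ('cV[R[i]]_n * {ffun 'I_m.+1 -> {ffun 'I_n -> {poly_N R[i]}}}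
   * {ffun 'I_m -> 'cV[R[i]]_n})%type.

Section SplineTau.
Context {R : realType} {n p q m : nat} (S : ddae R n p q m) (N : nat).

(* The segments [- tau_k, - tau_(k-1)], 1 <= k <= m.+1, are indexed by k - 1. *)
Definition seg_l (k : 'I_m.+1) : R := - ddae_tau S (lift ord0 k).
Definition seg_r (k : 'I_m.+1) : R := - ddae_tau S (widen_ord (leqnSn m.+1) k).

Lemma seg_lt k : seg_l k < seg_r k.
Proof. by rewrite ltrN2; apply: ddae_tau_lt; rewrite lift0. Qed.

Definition spline_eval (k : 'I_m.+1) (theta : R) (Xi : spline R n m N)
  : 'cV[R[i]]_n := \col_j (polyn (Xi k j)).[theta%:C].

Lemma spline_trunc_subproof (k : 'I_m.+1) (P : {poly_N.+1 R[i]}) :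
  legendre_trunc (seg_l k) (seg_r k) N P \is a poly_of_size N.
Proof. exact: legendre_trunc_size (seg_lt k) (size_npoly P). Qed.

Lemma spline_deriv_subproof (P : {poly_N.+1 R[i]}) :
  (polyn P)^`() \is a poly_of_size N.
Proof.
rewrite qualifE /=; have [->|P0] := eqVneq (polyn P) 0.
  by rewrite deriv0 size_poly0.
by rewrite -ltnS (leq_trans (lt_size_deriv P0)) ?size_npoly.
Qed.

Definition spline_trunc (k : 'I_m.+1) (Xi : spline R n m N)
  : {ffun 'I_n -> {poly_N R[i]}} :=
  [ffun j => NPoly (spline_trunc_subproof k (Xi k j))].

Definition spline_deriv (k : 'I_m.+1) (Xi : spline R n m N)
  : {ffun 'I_n -> {poly_N R[i]}} :=
  [ffun j => NPoly (spline_deriv_subproof (Xi k j))].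

Definition spline_E (Xi : spline R n m N) : spline_codom R n m N :=
  (ddae_E S *m spline_eval ord0 0 Xi,
   [ffun k => spline_trunc k Xi],
   [ffun=> 0]).

Definition spline_A (Xi : spline R n m N) : spline_codom R n m N :=
  (ddae_A S ord0 *m spline_eval ord0 0 Xi
     + \sum_(k < m.+1)
         ddae_A S (lift ord0 k) *m spline_eval k (seg_l k) Xi,
   [ffun k => spline_deriv k Xi],
   [ffun k : 'I_m =>
      let k1 := widen_ord (leqnSn m) k in let k2 := lift ord0 k in
      spline_eval k1 (seg_l k1) Xi - spline_eval k2 (seg_l k1) Xi]).

End SplineTau.

(* Main.v *)
Require Import Defs.
From HB Require Import structures.
From mathcomp Require Import all_boot all_order all_algebra.
From mathcomp Require Import qpoly.
From mathcomp Require Import all_classical all_reals all_analysis.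
From mathcomp Require Import complex ring lra zify.
Set Implicit Arguments.
Unset Strict Implicit.
Unset Printing Implicit Defensive.
Import Order.TTheory GRing.Theory Num.Theory.
Import numFieldNormedType.Exports.
Local Open Scope classical_set_scope.
Local Open Scope complex_scope.
Local Open Scope ring_scope.

(** A root lambda of the discretized pencil with Re lambda >= 0 is excluded as
follows.  On a segment of length h the tau equation
lambda T xi = xi' determines xi up to a factor, and forces its left end value
to be r_N (lambda h) times its right end value, where r_N is the diagonal Padé
approximant of exp (- z) (lemma tau_segment).  Gluing the segments, the
discretized pencil is bijective as soon as the characteristic matrix is
nonsingular after each factor exp (- lambda tau_k) is replaced by the product
of the values of r_N over the segments between 0 and - tau_k (lemma
spline_bijective).

For bounded lambda, r_N tends to the exponential locally uniformly (lemma
cvg_pade), the true characteristic matrix is nonsingular in the closed right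
half plane, and compactness gives a threshold for N.

For large lambda the approximation is useless, but |r_N| <= 1 in the right
half plane (lemma norm_pade_le1), so it suffices that
lambda E - A_0 - sum_k w_k A_k be nonsingular for all large lambda and all
|w_k| <= 1, uniformly in N (lemma large_frequency_neq0).  By the index
condition, a rescaled determinant of this matrix tends, as lambda goes to
infinity, to a polynomial G (w) with G (0) <> 0, and the claim is that G has no
zero in the closed unit polydisc (lemma polydisc_neq0).  This is where the
stability must be strong.  Around x + i omega with omega large, perturbations
of the delays of size O (1 / omega) give the numbers exp (- lambda theta_k)
arbitrary phases v_k, so that G (v_k exp (- x theta_k)) is a limit of functions
of x without zeros in a half plane Re x > - eps.  If the theta_k = n_k / M are
rational, it is a polynomial in exp (- x / M), so its zeros are isolated, and
Hurwitz's argument shows that it has none for Re x >= 0: G does not vanish on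
the tori |w_k| = t ^ n_k, 0 < t <= 1 (lemma torus_neq0).  As t grows from 0 to
1, no zero can therefore enter the polydisc (lemma disc_zero_free, used for one
coordinate at a time).

The complex analysis is reduced to polynomials: a zero-free function satisfies
a minimum principle, which for polynomials comes from averaging over roots of
unity, and which survives limits (lemmas min_principle_poly and
min_principle_lim); every holomorphic function at hand is a limit of
polynomials. *)

(** * Limits in the complex plane *)

(** Gives the complex numbers the topology of their modulus, so that the limit
laws of normed algebras apply to them. *)
#[non_forgetful_inheritance]
HB.instance Definition _ (R : realType) := NormedModule.copy R[i] R[i]^o.

Section Limits.
Context {R : realType}.
Local Notation C := R[i].

Lemma gt0_complexP (e : C) : 0 < e -> exists2 r : R, 0 < r & e = r%:C.
Proof. by case: e => a b; rewrite ltcE /= => /andP[/eqP-> a0]; exists a. Qed.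

Lemma norm_real_complex (r : R) : `|r%:C| = `|r|%:C :> C.
Proof. by rewrite normc_def /= expr0n addr0 sqrtr_sqr. Qed.

Section Filters.
Context {T : Type} {F : set_system T} {FF : Filter F}.

Lemma cvg_real_complex (f : T -> R) (a : R) :
  f @ F --> a -> (fun x => (f x)%:C) @ F --> a%:C.
Proof.
move=> fa; apply/cvgrPdist_lt => e /gt0_complexP[r r0 ->].
move/cvgrPdist_lt: fa => /(_ r r0); apply: filterS => x.
by rewrite -rmorphB norm_real_complex ltcR.
Qed.

Lemma cvg_complex (f g : T -> R) (a b : R) :
  f @ F --> a -> g @ F --> b -> (fun x => f x +i* g x) @ F --> a +i* b.
Proof.
move=> fa gb; rewrite [X in _ --> X](complexE (a +i* b)).
under eq_fun do rewrite (complexE (_ +i* _)).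
apply: cvgD; first exact: cvg_real_complex.
by apply: cvgM; [exact: cvg_cst|exact: cvg_real_complex].
Qed.

Lemma cvg_sumc I (r : seq I) (P : pred I) (f : I -> T -> C) (l : I -> C) :
  (forall i, P i -> f i @ F --> l i) ->
  (fun x => \sum_(i <- r | P i) f i x) @ F --> \sum_(i <- r | P i) l i.
Proof.
move=> fl; elim: r => [|j r IH].
  by under eq_fun do rewrite big_nil; rewrite big_nil; exact: cvg_cst.
under eq_fun do rewrite big_cons.
rewrite big_cons; case: ifPn => [/fl fj|_]; [exact: (cvgD fj IH)|exact: IH].
Qed.

Lemma cvg_prodc I (r : seq I) (P : pred I) (f : I -> T -> C) (l : I -> C) :
  (forall i, P i -> f i @ F --> l i) ->
  (fun x => \prod_(i <- r | P i) f i x) @ F --> \prod_(i <- r | P i) l i.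
Proof.
move=> fl; elim: r => [|j r IH].
  by under eq_fun do rewrite big_nil; rewrite big_nil; exact: cvg_cst.
under eq_fun do rewrite big_cons.
rewrite big_cons; case: ifPn => [/fl fj|_]; [exact: (cvgM fj IH)|exact: IH].
Qed.

Lemma cvg_expc (f : T -> C) (l : C) k : f @ F --> l -> (fun x => f x ^+ k) @ F --> l ^+ k.
Proof.
move=> fl; rewrite -[k]card_ord -prodr_const.
by under eq_fun do rewrite -prodr_const; exact: cvg_prodc.
Qed.

Lemma cvg_det n (A : T -> 'M[C]_n) (B : 'M[C]_n) :
  (forall i j, (fun x => A x i j) @ F --> B i j) ->
  (fun x => \det (A x)) @ F --> \det B.
Proof.
move=> AB; apply: cvg_sumc => s _.
by apply: cvgM; [exact: cvg_cst|exact: cvg_prodc].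
Qed.

Lemma cvg_mulmx p n k (A : T -> 'M[C]_(p, n)) (B : T -> 'M[C]_(n, k))
    (A0 : 'M[C]_(p, n)) (B0 : 'M[C]_(n, k)) :
  (forall i j, (fun x => A x i j) @ F --> A0 i j) ->
  (forall i j, (fun x => B x i j) @ F --> B0 i j) ->
  forall i j, (fun x => (A x *m B x) i j) @ F --> (A0 *m B0) i j.
Proof.
move=> HA HB i j; rewrite mxE; under eq_fun do rewrite mxE.
by apply: cvg_sumc => l _; exact: (cvgM (HA i l) (HB l j)).
Qed.

Lemma cvg_neq0 (f : T -> C) (l : C) : l != 0 -> f @ F --> l -> \forall x \near F, f x != 0.
Proof.
move=> l0 /cvgrPdist_lt/(_ `|l|); rewrite normr_gt0 => /(_ l0).
by apply: filterS => x; apply: contraTneq => ->; rewrite subr0 ltxx.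
Qed.

Lemma cvg_norm_lt (f g : T -> C) (a b : C) : `|a| < `|b| ->
  f @ F --> a -> g @ F --> b -> \forall x \near F, `|f x| < `|g x|.
Proof.
move=> ab fa gb; pose e : C := (`|b| - `|a|) / 2.
have e0 : 0 < e by rewrite divr_gt0 // subr_gt0.
have e2 : `|b| = `|a| + e + e.
  by rewrite -addrA -mulr2n -mulr_natr /e divfK ?pnatr_eq0 // addrC subrK.
move/cvgrPdist_lt: fa => /(_ e e0) fa; move/cvgrPdist_lt: gb => /(_ e e0) gb.
apply: filterS2 fa gb => x fx gx.
have fx' : `|f x| < `|a| + e.
  rewrite -(subrK a (f x)) addrC (le_lt_trans (ler_normD _ _)) //.
  by rewrite ltrD2l distrC.
apply: (lt_trans fx'); rewrite -(ltrD2r e) -e2.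
rewrite -[b](subrK (g x)) addrC (le_lt_trans (ler_normD _ _)) //.
by rewrite ltrD2l.
Qed.

End Filters.

Lemma compact_rect (a b c d : R) :
  compact [set z : C | a <= complex.Re z <= b /\ c <= complex.Im z <= d].
Proof.
have -> : [set z : C | a <= complex.Re z <= b /\ c <= complex.Im z <= d] =
    [set p.1 +i* p.2 | p in `[a, b] `*` `[c, d]].
  apply/seteqP; split => [[x y] /= [xab ycd]|_ [[x y] /= [xab ycd] <-]].
    by exists (x, y); rewrite //= !in_itv.
  by rewrite !in_itv /= in xab ycd.
apply: continuous_compact; last by apply: compact_setX; exact: segment_compact.
apply: continuous_subspaceT => p.
by apply: cvg_complex; [exact: cvg_fst|exact: cvg_snd].
Qed.

Lemma Re_le_norm (z : C) (r : R) : `|z| <= r%:C -> - r <= complex.Re z <= r.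
Proof. by move=> zr; rewrite -ler_norml -lecR (le_trans (normc_ge_Re z)). Qed.

Lemma Im_le_norm (z : C) (r : R) : `|z| <= r%:C -> - r <= complex.Im z <= r.
Proof.
move=> zr; rewrite -ler_norml -normrN -ReiNIm ler_norml.
by apply: Re_le_norm; rewrite normrM complexiE normCi mulr1.
Qed.

Lemma compact_bounded_closed (A : set C) (r : R) : closed A ->
  (forall z, A z -> `|z| <= r%:C) -> compact A.
Proof.
move=> cA Ar; apply: (subclosed_compact cA (@compact_rect (- r) r (- r) r)).
by move=> z /Ar zr; split; [exact: Re_le_norm|exact: Im_le_norm].
Qed.

End Limits.

(** * Minimum principle *)

(** The near-covering form of compactness.  It is the source of
the uniform statements below: an open condition that holds in the limit at each
point of a compact set holds on the whole set before the limit. *)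
Lemma near_compact (X : topologicalType) (K : set X) I (F : set_system I)
    {FF : Filter F} (P : I -> X -> Prop) : compact K ->
  (forall x, K x -> \forall p \near filter_prod (nbhs x) F, P p.2 p.1) ->
  \forall i \near F, forall x, K x -> P i x.
Proof. by rewrite compact_near_coveringP => cov PF; have := cov I F P _; apply. Qed.

Section MinPrinciple.
Context {R : realType}.
Local Notation C := R[i].

Lemma cvg_Re T (F : set_system T) {FF : Filter F} (f : T -> C) (a : C) :
  f @ F --> a -> (fun x => complex.Re (f x)) @ F --> complex.Re a.
Proof.
move=> fa; apply/cvgrPdist_lt => e e0.
move/cvgrPdist_lt: fa => /(_ e%:C); rewrite ltcR => /(_ e0).
apply: filterS => x; rewrite -raddfB -ltcR; exact/le_lt_trans/normc_ge_Re.
Qed.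

Lemma Re_normE (z : C) : (complex.Re `|z|)%:C = `|z|.
Proof. by rewrite normc_def. Qed.

Lemma continuous_Re_dist (z0 : C) : continuous (fun z : C => complex.Re `|z - z0|).
Proof.
move=> z; apply: (@cvg_Re C (nbhs z) _ (fun z => `|z - z0|) `|z - z0|).
by apply: cvg_norm; apply: cvgB; [exact: cvg_id|exact: cvg_cst].
Qed.

Lemma compact_disc (z0 : C) (r : R) : compact [set z : C | `|z - z0| <= r%:C].
Proof.
apply: (@compact_bounded_closed _ _ (complex.Re `|z0| + r)).
  rewrite (_ : [set _ | _] = (fun z => complex.Re `|z - z0|) @^-1` [set x | x <= r]).
    by apply: preimage_closed; [move=> z _; exact: continuous_Re_dist|exact: closed_le].
  by apply/seteqP; split=> z /=; rewrite -lecR Re_normE.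
move=> z /= zr; rewrite rmorphD /= Re_normE -[z](subrK z0) addrC.
by rewrite (le_trans (ler_normD _ _)) // lerD2l.
Qed.

Lemma compact_unit_disc : compact [set z : C | `|z| <= 1].
Proof.
have := @compact_disc 0 1; rewrite (_ : [set z | _] = [set z : C | `|z| <= 1]) //.
by apply/seteqP; split=> z /=; rewrite subr0.
Qed.

Lemma compact_circle (z0 : C) (r : R) : compact [set z : C | `|z - z0| = r%:C].
Proof.
apply: subclosed_compact (@compact_disc z0 r) _ => [|z /= ->] //.
rewrite (_ : [set _ | _] = (fun z => complex.Re `|z - z0|) @^-1` [set x | x = r]).
  by apply: preimage_closed; [move=> z _; exact: continuous_Re_dist|exact: closed_eq].
apply/seteqP; split=> z zr; last by rewrite /mkset -zr Re_normE.
by apply: complexI; rewrite Re_normE.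
Qed.

(** The minimum principle of holomorphic functions without zeros in a disc
holds with |f z0| on the right.  The factor 2 leaves room for a proof that uses
finitely many points of the circle only. *)
Definition min_principle (f : C -> C) (z0 : C) (r : R) : Prop :=
  exists2 z, `|z - z0| = r%:C & `|f z| <= `|2 * f z0|.

(** If the limit violated the principle, the strict reverse inequality would
hold on the compact circle and, being open, would pass to the functions near
the limit. *)
Lemma min_principle_lim I (F : set_system I) {FF : ProperFilter F}
    (h : I -> C -> C) (g : C -> C) (z0 : C) (r : R) :
  (forall z, `|z - z0| = r%:C ->
     h p.2 p.1 @[p --> filter_prod (nbhs z) F] --> g z) ->
  h i z0 @[i --> F] --> g z0 ->
  (\forall i \near F, min_principle (h i) z0 r) -> min_principle g z0 r.
Proof.
move=> hg hg0 hmin; apply: contrapT => /forall2NP gmin.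
have glt z : `|z - z0| = r%:C -> `|2 * g z0| < `|g z|.
  by move=> zr; have [/(_ zr)//|/negP] := gmin z; rewrite -real_ltNge ?normr_real.
have cov : \forall i \near F, forall z, `|z - z0| = r%:C -> `|2 * h i z0| < `|h i z|.
  apply: (near_compact (@compact_circle z0 r)) => z zr.
  apply: (cvg_norm_lt (glt _ zr)); last exact: hg.
  apply: cvgM; first exact: cvg_cst.
  exact: (cvg_comp snd (fun i => h i z0) cvg_snd hg0).
have [i [hi]] := filter_ex (filterI hmin cov).
case: hi => z zr zle /(_ z zr) => hlt.
by have := lt_le_trans hlt zle; rewrite ltxx.
Qed.

Lemma cvg_horner T (F : set_system T) {FF : Filter F} (p : {poly C}) (f : T -> C) l :
  f @ F --> l -> (fun x => p.[f x]) @ F --> p.[l].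
Proof.
move=> fl; rewrite horner_coef; under eq_fun do rewrite horner_coef.
apply: cvg_sumc => i _; apply: cvgM; first exact: cvg_cst.
exact: cvg_expc.
Qed.

(** A discrete form of Jensen's formula.  Write p as a product of factors
z - c and multiply the values of p at the points z0 + r u, for u over the L-th
roots of unity: a root c outside the disc contributes |(c - z0) ^ L - r ^ L|,
which is at most 2 |c - z0| ^ L.  So the product of the L values is at most
2 ^ d |p z0| ^ L with d the degree.  For L = d + 1 they cannot all exceed
2 |p z0|. *)
Lemma min_principle_poly (p : {poly C}) (z0 : C) (r : R) : 0 < r ->
  (forall z, `|z - z0| <= r%:C -> p.[z] != 0) -> min_principle (horner p) z0 r.
Proof.
move=> r0 pneq0; apply: contrapT => /forall2NP pmin.
have rC0 : 0 < r%:C :> C by rewrite ltcR.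
have rCneq0 : r%:C != 0 :> C by rewrite gt_eqF.
have [rs pE] := closed_field_poly_normal p.
pose d := size rs; pose L := d.+1.
have [us] := closed_field_poly_normal ('X^L - 1 : {poly C}).
rewrite lead_coefXnsubC // scale1r => usE.
have usP a : \prod_(u <- us) (a - u) = a ^+ L - 1.
  have := congr1 (horner^~ a) usE; rewrite /= hornerD hornerN hornerXn hornerC.
  by move=> ->; rewrite horner_prod; apply: eq_bigr => u _; rewrite hornerXsubC.
have sus : size us = L.
  have := congr1 (@size _ \o polyseq) usE.
  by rewrite /= size_XnsubC // size_prod_XsubC => -[].
have us1 u : u \in us -> `|u| = 1.
  move=> uus; apply/eqP; rewrite -(@pexpr_eq1 _ _ L) // -normrX.
  have : u ^+ L - 1 == 0.
    by rewrite -usP prodf_seq_eq0; apply/hasP; exists u => //=; rewrite subrr.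
  by rewrite subr_eq0 => /eqP->; rewrite normr1.
have pz z : `|p.[z]| = `|lead_coef p| * \prod_(c <- rs) `|z - c|.
  rewrite {1}pE hornerZ normrM horner_prod normr_prod; congr (_ * _).
  by apply: eq_bigr => c _; rewrite hornerXsubC.
have plt u : u \in us -> `|2 * p.[z0]| <= `|p.[z0 + r%:C * u]|.
  move=> uus; have [[]|/negP] := pmin (z0 + r%:C * u).
    by rewrite (addrC z0) addrK normrM (us1 u) // mulr1 norm_real_complex gtr0_norm.
  by rewrite -real_ltNge ?normr_real // => /ltW.
have p0 : 0 < `|p.[z0]| by rewrite normr_gt0 pneq0 // subrr normr0 ltW.
have prod_cst (xs : seq C) (a : C) : \prod_(u <- xs) a = a ^+ size xs.
  by rewrite big_const_seq count_predT iter_mulr_1.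
have cst (a : C) : \prod_(u <- us) a = a ^+ L by rewrite prod_cst sus.
have low : `|2 * p.[z0]| ^+ L <= \prod_(u <- us) `|p.[z0 + r%:C * u]|.
  rewrite -cst big_seq [leRHS]big_seq; apply: ler_prod => u uus.
  by rewrite normr_ge0 plt.
have rsE c : c \in rs -> r%:C < `|z0 - c|.
  move=> crs; rewrite real_ltNge ?normr_real ?gtr0_real //.
  apply/negP; rewrite distrC => /pneq0/negP; apply; rewrite pE -rootE.
  have [l0|l0] := eqVneq (lead_coef p) 0.
    by move: p0; rewrite pE l0 scale0r horner0 normr0 ltxx.
  by rewrite rootZ // root_prod_XsubC.
have up : \prod_(u <- us) `|p.[z0 + r%:C * u]| <= 2 ^+ d * `|p.[z0]| ^+ L.
  under eq_bigr do rewrite pz.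
  rewrite big_split /= cst pz exprMn mulrCA ler_wpM2l ?exprn_ge0 //.
  rewrite exchange_big /= -prodrXl -(prod_cst rs) -big_split /=.
  rewrite big_seq [leRHS]big_seq; apply: ler_prod => c crs.
  rewrite prodr_ge0 //=.
  (* The roots of unity are centred at 0: the factor is |r u - (c - z0)|. *)
  pose a := (c - z0) / r%:C.
  have aE : `|a| = `|z0 - c| / r%:C by rewrite normrM normfV (gtr0_norm rC0) distrC.
  have a1 : 1 <= `|a|.
    by rewrite aE ler_pdivlMr // mul1r ltW // rsE.
  have -> : \prod_(u <- us) `|z0 + r%:C * u - c| = r%:C ^+ L * `|a ^+ L - 1|.
    rewrite -usP normr_prod -cst -big_split /=; apply: eq_bigr => u _.
    rewrite -[in RHS](gtr0_norm rC0) -normrM mulrBr [_ * a]mulrC /a divfK // -[LHS]normrN.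
    by congr `|_|; ring.
  have rL0 : 0 <= (r%:C : C) ^+ L by rewrite exprn_ge0 // ltW.
  apply: le_trans (ler_wpM2l rL0 (ler_normB _ _)) _; rewrite normr1 normrX.
  apply: (@le_trans _ _ (r%:C ^+ L * (2 * `|a| ^+ L))).
    by rewrite ler_wpM2l // mulr_natl mulr2n lerD2l exprn_ege1.
  by rewrite mulrCA -exprMn aE [r%:C * _]mulrC divfK.
have := le_trans low up; rewrite normrM exprMn normr_nat ler_pM2r ?exprn_gt0 //.
by rewrite ler_eXn2l // ?ltr1n // ltnn.
Qed.
End MinPrinciple.

(** * Polynomial functions *)

Section PolyFun.
Context {R : realType}.
Local Notation C := R[i].
Implicit Types f g : C -> C.

(** Functions defined by determinants are recognized as polynomial by their
closure properties, without naming the polynomial. *)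
Definition polyfun f : Prop := exists p : {poly C}, forall z, f z = p.[z].

Lemma eq_polyfun f g : f =1 g -> polyfun g -> polyfun f.
Proof. by move=> fg [p gp]; exists p => z; rewrite fg. Qed.

Lemma polyfun_cst (a : C) : polyfun (fun=> a).
Proof. by exists a%:P => z; rewrite hornerC. Qed.

Lemma polyfun_id : polyfun id.
Proof. by exists 'X => z; rewrite hornerX. Qed.

Lemma polyfunD f g : polyfun f -> polyfun g -> polyfun (fun z => f z + g z).
Proof. by move=> [p fp] [q gq]; exists (p + q) => z; rewrite hornerD fp gq. Qed.

Lemma polyfunM f g : polyfun f -> polyfun g -> polyfun (fun z => f z * g z).
Proof. by move=> [p fp] [q gq]; exists (p * q) => z; rewrite hornerM fp gq. Qed.

Lemma polyfunX f k : polyfun f -> polyfun (fun z => f z ^+ k).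
Proof. by move=> [p fp]; exists (p ^+ k) => z; rewrite horner_exp fp. Qed.

Lemma polyfun_sum I (r : seq I) (P : pred I) (F : I -> C -> C) :
  (forall i, P i -> polyfun (F i)) -> polyfun (fun z => \sum_(i <- r | P i) F i z).
Proof.
move=> FP; elim: r => [|j r IH].
  by apply: eq_polyfun (polyfun_cst _) => z; rewrite big_nil.
have [Pj|nPj] := boolP (P j).
  by apply: eq_polyfun (polyfunD (FP j Pj) IH) => z; rewrite big_cons Pj.
by apply: eq_polyfun IH => z; rewrite big_cons (negbTE nPj).
Qed.

Lemma polyfun_prod I (r : seq I) (P : pred I) (F : I -> C -> C) :
  (forall i, P i -> polyfun (F i)) -> polyfun (fun z => \prod_(i <- r | P i) F i z).
Proof.
move=> FP; elim: r => [|j r IH].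
  by apply: eq_polyfun (polyfun_cst _) => z; rewrite big_nil.
have [Pj|nPj] := boolP (P j).
  by apply: eq_polyfun (polyfunM (FP j Pj) IH) => z; rewrite big_cons Pj.
by apply: eq_polyfun IH => z; rewrite big_cons (negbTE nPj).
Qed.

Lemma polyfun_mulmx p n k (A : C -> 'M[C]_(p, n)) (B : C -> 'M[C]_(n, k)) :
  (forall i j, polyfun (fun z => A z i j)) ->
  (forall i j, polyfun (fun z => B z i j)) ->
  forall i j, polyfun (fun z => (A z *m B z) i j).
Proof.
move=> HA HB i j; apply: (@eq_polyfun _ (fun z => \sum_l A z i l * B z l j)) => [z|].
  by rewrite mxE.
by apply: polyfun_sum => l _; exact: polyfunM.
Qed.

Lemma polyfun_det n (A : C -> 'M[C]_n) :
  (forall i j, polyfun (fun z => A z i j)) -> polyfun (fun z => \det (A z)).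
Proof.
move=> HA; apply: polyfun_sum => s _; apply: polyfunM; first exact: polyfun_cst.
exact: polyfun_prod.
Qed.

Lemma min_principle_polyfun f (z0 : C) (r : R) : polyfun f -> 0 < r ->
  (forall z, `|z - z0| <= r%:C -> f z != 0) -> min_principle f z0 r.
Proof.
move=> [p fp] r0 f0; have [|z zr zp] := @min_principle_poly R p z0 r r0.
  by move=> z zr; rewrite -fp f0.
by exists z => //; rewrite !fp.
Qed.

Lemma polyfun_isolated_zero f (a z0 : C) : polyfun f -> f a != 0 ->
  \forall z \near z0, z != z0 -> f z != 0.
Proof.
move=> [p fp] fa.
have p0 : p != 0 by apply: contraNneq fa => p0; rewrite fp p0 horner0.
have [k [q]] := multiplicity_XsubC p z0; rewrite p0 rootE /= => q0 pE.
have : \forall z \near z0, q.[z] != 0.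
  have qc : q.[z] @[z --> z0] --> q.[z0].
    by apply: (@cvg_horner R C (nbhs z0) _ q id z0); exact: cvg_id.
  exact: (cvg_neq0 q0 qc).
apply: filterS => z qz zz0; rewrite fp pE hornerM mulf_neq0 // horner_exp.
by rewrite hornerXsubC expf_neq0 // subr_eq0.
Qed.

Lemma near_norm_ball (z0 : C) (P : C -> Prop) : (\forall z \near z0, P z) ->
  exists2 e : R, 0 < e & forall z, `|z - z0| < e%:C -> P z.
Proof.
move/nbhs_ballP => [_ /= /gt0_complexP[e e0 ->] eP]; exists e => // z ze.
by apply: eP; rewrite /ball /= distrC.
Qed.

(** The parameters t for which f t has no zero in the disc form an open subset
of [0, 1], because the disc is compact.  They also form a closed one: at a
limit of good parameters, a zero in the open disc would be isolated, hence
would contradict the minimum principle on a small circle around it, and the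
unit circle carries no zero by hypothesis. *)
Lemma disc_zero_free (f : R -> C -> C) :
  (forall t, polyfun (f t)) ->
  (forall t z, f p.1 p.2 @[p --> filter_prod (nbhs t) (nbhs z)] --> f t z) ->
  (forall t z, 0 <= t <= 1 -> `|z| = 1 -> f t z != 0) ->
  (forall z, `|z| <= 1 -> f 0 z != 0) ->
  forall t z, 0 <= t <= 1 -> `|z| <= 1 -> f t z != 0.
Proof.
move=> fpoly fcont fcirc f0.
pose Z := [set t : R | forall z, `|z| <= 1 -> f t z != 0].
pose B := `[0, 1]%classic `&` Z.
have fcvg t z : f p.2 p.1 @[p --> filter_prod (nbhs z) (nbhs t)] --> f t z.
  have sw : (p.2, p.1) @[p --> filter_prod (nbhs z) (nbhs t)] -->
      filter_prod (nbhs t) (nbhs z).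
    exact: (cvg_pair cvg_snd cvg_fst).
  exact: (cvg_comp _ _ sw (fcont t z)).
have disc1 := @compact_unit_disc R.
suff BE : B = `[0, 1]%classic.
  move=> t z t01; have : B t by rewrite BE /= in_itv.
  by case=> _; apply.
apply: segment_connected.
- by exists 0; split=> //=; rewrite in_itv /= lexx ler01.
- exists (interior Z); first exact: open_interior.
  apply/seteqP; split=> t [t01 Zt]; split=> //; last exact: interior_subset Zt.
  apply: (@near_compact _ _ _ (nbhs t) _ (fun t z => f t z != 0) disc1) => z z1.
  exact: (cvg_neq0 (Zt z z1) (fcvg t z)).
- exists (closure B); first exact: closed_closure.
  apply/seteqP; split=> t [t01 Bt]; split=> //.
    exact: subset_closure.
  have t01' : 0 <= t <= 1 by move: t01; rewrite /= in_itv.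
  move=> z z1; apply/eqP => fz.
  have {}z1 : `|z| < 1.
    rewrite lt_neqAle z1 andbT; apply/eqP => z1'.
    by have := fcirc t z t01' z1'; rewrite fz eqxx.
  have ft1 : f t 1 != 0 by apply: fcirc => //; rewrite normr1.
  have [e e0 eP] := near_norm_ball (polyfun_isolated_zero z (fpoly t) ft1).
  have d0 : 0 < 1 - complex.Re `|z| by rewrite subr_gt0 -ltcR Re_normE.
  (* The disc of radius r around z lies in the unit disc and in the
  neighbourhood where z is the only zero. *)
  pose r := Num.min (e / 2) (1 - complex.Re `|z|).
  have r0 : 0 < r by rewrite lt_min d0 divr_gt0.
  pose F := within B (nbhs t).
  have FF : ProperFilter F by exact: within_nbhs_proper.
  have [w wr] : min_principle (f t) z r.
    apply: (@min_principle_lim _ _ F _ f).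
    - move=> w _.
      have sw : (p.2, p.1) @[p --> filter_prod (nbhs w) F] -->
          filter_prod (nbhs t) (nbhs w).
        exact: (cvg_pair (cvg_trans cvg_snd (cvg_within _)) cvg_fst).
      exact: (cvg_comp _ _ sw (fcont t w)).
    - have c1 : (t', z) @[t' --> F] --> filter_prod (nbhs t) (nbhs z).
        exact: (cvg_pair (cvg_within _) (cvg_cst z)).
      exact: (cvg_comp _ _ c1 (fcont t z)).
    - rewrite near_withinE; near=> t' => -[_ Zt'].
      apply: min_principle_polyfun => // w wr; apply: Zt'.
      rewrite -[w](subrK z) (le_trans (ler_normD _ _)) //.
      rewrite -lerBrDr (le_trans wr) // -Re_normE -rmorphB lecR.
      by rewrite ge_min lexx orbT.
  rewrite fz mulr0 normr0 normr_le0 => /eqP fw.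
  have := eP w; rewrite wr fw eqxx ltcR => H; apply: (notF (H _ _)).
    by rewrite gt_min ltr_pdivrMr // mulr_natr mulr2n ltrDl e0.
  by apply/eqP => wz; move: r0; rewrite -ltcR -wr wz subrr normr0 ltxx.
Unshelve. all: by end_near. Qed.

End PolyFun.

(** * Complex exponential *)

Section ComplexExp.
Context {R : realType}.
Local Notation C := R[i].

Lemma cexpD (y z : C) : cexp (y + z) = cexp y * cexp z.
Proof.
case: y z => [a b] [c d]; rewrite /cexp /= expRD sinD cosD rmorphM /=.
rewrite mulrACA; congr (_ * _); simpc; congr (_ +i* _).
by rewrite addrC.
Qed.

Lemma cexp0 : cexp (0 : C) = 1.
Proof. by rewrite /cexp /= expR0 cos0 sin0 mul1r. Qed.

Lemma norm_cexp (z : C) : `|cexp z| = (expR (complex.Re z))%:C.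
Proof.
rewrite normrM norm_real_complex (gtr0_norm (expR_gt0 _)) normc_def /=.
by rewrite cos2Dsin2 sqrtr1 mulr1.
Qed.

Lemma cexp_neq0 (z : C) : cexp z != 0.
Proof. by rewrite -normr_gt0 norm_cexp ltcR expR_gt0. Qed.

Lemma cexpM_natl k (z : C) : cexp (k%:R * z) = cexp z ^+ k.
Proof.
elim: k => [|k IH]; first by rewrite mul0r cexp0 expr0.
by rewrite -natr1 mulrDl mul1r cexpD IH exprSr.
Qed.

Lemma cvg_Im T (F : set_system T) {FF : Filter F} (f : T -> C) (a : C) :
  f @ F --> a -> (fun x => complex.Im (f x)) @ F --> complex.Im a.
Proof.
move=> fa; rewrite -[complex.Im a]opprK -ReiNIm.
have -> : (fun x => complex.Im (f x)) = (fun x => - complex.Re (f x * 'i)).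
  by apply/funext => x; rewrite ReiNIm opprK.
apply: cvgN; apply: (@cvg_Re R T F FF (fun x => f x * 'i)).
exact: (cvgM fa (cvg_cst _)).
Qed.

Lemma cvg_cexp T (F : set_system T) {FF : Filter F} (f : T -> C) (a : C) :
  f @ F --> a -> (fun x => cexp (f x)) @ F --> cexp a.
Proof.
move=> fa; have fRe := @cvg_Re _ _ _ FF _ _ fa; have fIm := @cvg_Im _ _ FF _ _ fa.
apply: cvgM.
  apply: cvg_real_complex.
  exact: (@continuous_cvg T R R F FF _ (@expR R) _ (@continuous_expR R (complex.Re a)) fRe).
apply: cvg_complex.
  exact: (@continuous_cvg T R R F FF _ (@cos R) _ (@continuous_cos R (complex.Im a)) fIm).
exact: (@continuous_cvg T R R F FF _ (@sin R) _ (@continuous_sin R (complex.Im a)) fIm).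
Qed.

Lemma mean_value_bound (f df : R -> R) (b M : R) :
  (forall x : R, is_derive x 1 f (df x)) ->
  (forall x, `|x| <= `|b| -> `|df x| <= M) -> `|f b - f 0| <= M * `|b|.
Proof.
move=> fdf dfM.
have fc : continuous f.
  move=> x; apply: differentiable_continuous; apply/derivable1_diffP.
  by have [] := fdf x.
have [b0|b0] := leP 0 b.
  have [|c cb ->] := MVT_segment b0 (fun x _ => fdf x).
    exact: continuous_subspaceT.
  rewrite subr0 normrM ler_wpM2r // dfM //.
  by move: cb; rewrite in_itv /= => /andP[c0 cb]; rewrite !ger0_norm.
have [|c cb] := MVT_segment (ltW b0) (fun x _ => fdf x).
  exact: continuous_subspaceT.
rewrite distrC => ->; rewrite sub0r normrM normrN ler_wpM2r // dfM //.
by move: cb; rewrite in_itv /= => /andP[bc c0]; rewrite !ler0_norm ?lerN2 // ltW.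
Qed.

Lemma norm_sin_le (x : R) : `|sin x| <= `|x|.
Proof.
have := @mean_value_bound sin cos x 1 (@is_derive_sin R).
by rewrite sin0 subr0 mul1r; apply => y _; rewrite cos_max.
Qed.

Lemma norm_cosB1_le (x : R) : `|cos x - 1| <= x ^+ 2.
Proof.
have := @mean_value_bound cos (fun x => - sin x) x `|x| (@is_derive_cos R).
rewrite cos0 -expr2 (real_normK (num_real _)); apply => y yx.
by rewrite normrN (le_trans (norm_sin_le y)).
Qed.

Lemma norm_sinB_le (x : R) : `|x| <= 1 -> `|sin x - x| <= x ^+ 2.
Proof.
move=> x1; have := @mean_value_bound (fun x => sin x - x) (fun x => cos x - 1) x (x ^+ 2).
rewrite sin0 !subr0 => H; apply: le_trans (H _ _) _.
- move=> y yx; rewrite (le_trans (norm_cosB1_le y)) //.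
  by rewrite -(real_normK (num_real y)) -(real_normK (num_real x)) lerXn2r ?nnegrE.
- by rewrite ler_piMr // sqr_ge0.
Qed.

Lemma expRB1_le (x : R) : `|x| <= 1 / 2 ->
  0 <= expR x - 1 - x <= 2 * x ^+ 2.
Proof.
rewrite ler_norml => /andP[x1 x2].
have h : (expR x) * (1 - x) <= 1.
  have E : expR x * expR (- x) = 1 by rewrite -expRD subrr expR0.
  by rewrite -[leRHS]E ler_wpM2l ?expR_ge0 //; exact: expR_ge1Dx.
by have := expR_ge1Dx x => h2; apply/andP; split; nra.
Qed.

Lemma norm_complex_le (a b : R) : `|a +i* b : C| <= (`|a| + `|b|)%:C.
Proof.
rewrite (complexE (a +i* b)) (le_trans (ler_normD _ _)) // rmorphD /=.
by rewrite normrM complexiE normCi mul1r !norm_real_complex.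
Qed.

(** The complex exponential is only known through expR, cos and sin, so its
first-order expansion is assembled from real ones. *)
Lemma cexp_taylor1 (z : C) : `|z| <= (1 / 2)%:C ->
  `|cexp z - 1 - z| <= 5%:R * `|z| ^+ 2.
Proof.
move=> z1; have /andP[a1 a2] := Re_le_norm z1; have /andP[b1 b2] := Im_le_norm z1.
have {a1 a2} a1 : `|complex.Re z| <= 1 / 2 by rewrite ler_norml a1.
have {b1 b2} b1 : `|complex.Im z| <= 1 / 2 by rewrite ler_norml b1.
rewrite -add_Re2_Im2; case: z {z1} a1 b1 => a b /= a1 b1.
have -> : cexp (a +i* b) - 1 - (a +i* b) =
    (expR a * cos b - 1 - a) +i* (expR a * sin b - b).
  by rewrite /cexp /=; simpc.
rewrite (le_trans (norm_complex_le _ _)) // -[5%:R](rmorph_nat (real_complex R)).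
rewrite -rmorphM lecR /=.
have b2 : `|b| <= 1 by apply: le_trans b1 _; lra.
have := expRB1_le a1; have := norm_cosB1_le b; have := norm_sinB_le b2.
have e0 := expR_gt0 a; set e := expR a in e0 *; set c := cos b; set s := sin b.
move: a1 b1; rewrite !ler_norml => /andP[a1 a3] /andP[b1 b3].
move=> /andP[s1 s2] /andP[c1 c2] /andP[h1 h2].
have e2 : e <= 2 by nra.
have p1 : e * (c - 1) <= 2 * b ^+ 2 by nra.
have p2 : - (2 * b ^+ 2) <= e * (c - 1) by nra.
have p3 : e * (s - b) <= 2 * b ^+ 2 by nra.
have p4 : - (2 * b ^+ 2) <= e * (s - b) by nra.
have d1 : (e - 1 - a) * b <= a ^+ 2 by nra.
have d2 : - a ^+ 2 <= (e - 1 - a) * b by nra.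
have p5 : (e - 1) * b <= 3 / 2 * a ^+ 2 + b ^+ 2 by nra.
have p6 : - (3 / 2 * a ^+ 2 + b ^+ 2) <= (e - 1) * b by nra.
have q1 : `|e * c - 1 - a| <= 2 * a ^+ 2 + 2 * b ^+ 2.
  by rewrite ler_norml; apply/andP; split; nra.
have q2 : `|e * s - b| <= 3 / 2 * a ^+ 2 + 3 * b ^+ 2.
  rewrite ler_norml; apply/andP; split; nra.
lra.
Qed.

Lemma cexp_neq1 (z : C) : z != 0 -> `|z| < (1 / 5)%:C -> cexp z != 1.
Proof.
move=> z0 z5; apply/eqP => e1.
have : `|cexp z - 1 - z| <= 5%:R * `|z| ^+ 2.
  apply: cexp_taylor1; rewrite (le_trans (ltW z5)) // lecR; lra.
have z0' : 0 < `|z| by rewrite normr_gt0.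
rewrite e1 subrr sub0r normrN expr2 mulrA -{1}[`|z|]mul1r ler_pM2r // => h.
move: z5; rewrite -(@ltr_pM2l _ (5%:R : C)) ?ltr0n // => h2.
have e5 : 5%:R * (1 / 5)%:C = 1 :> C.
  rewrite -(rmorph_nat (real_complex R)) -rmorphM.
  by rewrite (_ : 5%:R * (1 / 5) = 1 :> R) //; field.
by have := le_lt_trans h h2; rewrite e5 ltxx.
Qed.

Lemma norm_subXX (u v : C) (M : R) k : 1 <= M -> `|u| <= M%:C -> `|v| <= M%:C ->
  `|u ^+ k - v ^+ k| <= `|u - v| * (k%:R * M ^+ k)%:C.
Proof.
move=> M1 uM vM; rewrite subrXX normrM ler_wpM2l //.
have M0 : 0 <= M by apply: le_trans M1.
apply: (le_trans (ler_norm_sum _ _ _)).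
rewrite rmorphM rmorph_nat /= mulr_natl -[k in leRHS]card_ord -sumr_const.
apply: ler_sum => i _; rewrite normrM !normrX rmorphXn /=.
apply: (@le_trans _ _ (M%:C ^+ (k.-1 - i) * M%:C ^+ i)).
  by apply: ler_pM; rewrite ?exprn_ge0 //; apply: lerXn2r; rewrite // nnegrE ?ler0c.
rewrite -exprD -!rmorphXn lecR ler_weXn2l //.
have k0 : (0 < k)%N by apply: leq_ltn_trans (ltn_ord i).
by rewrite card_ord subnK ?leq_pred // -ltnS prednK.
Qed.

(** Both sides are k.+1-st powers, of 1 + w and of cexp w with
w = z / k.+1, and these bases differ by O (|w| ^ 2). *)
Lemma expn_cexp_bound (z : C) (r : R) k : `|z| <= r%:C -> 2 * r <= k.+1%:R ->
  `|(1 + z / k.+1%:R) ^+ k.+1 - cexp z| <= (5 * r ^+ 2 * expR r / k.+1%:R)%:C.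
Proof.
move=> zr rk.
have r0 : 0 <= r by rewrite -ler0c (le_trans _ zr).
have k0 : 0 < k.+1%:R :> R by rewrite ltr0n.
have kC0 : k.+1%:R != 0 :> C by rewrite pnatr_eq0.
pose w : C := z / k.+1%:R; pose s := r / k.+1%:R.
have ws : `|w| <= s%:C.
  rewrite normrM normfV normr_nat rmorphM /= fmorphV /= rmorph_nat.
  by rewrite ler_pM2r // invr_gt0 ltr0n.
have s0 : 0 <= s by rewrite divr_ge0.
have s2 : s <= 1 / 2 by rewrite ler_pdivrMr //; lra.
rewrite -[z in cexp z](divfK kC0) -/w [w * _]mulrC cexpM_natl.
have M1 : 1 <= expR s by rewrite -[1]expR0 ler_expR.
apply: (le_trans (@norm_subXX (1 + w) (cexp w) (expR s) k.+1 M1 _ _)).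
- rewrite (le_trans (ler_normD _ _)) // normr1 (@le_trans _ _ (1 + s)%:C) //.
    by rewrite rmorphD lerD2l.
  by rewrite lecR expR_ge1Dx.
- by rewrite norm_cexp lecR ler_expR; have /andP[] := Re_le_norm ws.
have b : `|(1 + w) - cexp w| <= (5 * s ^+ 2)%:C.
  rewrite distrC opprD addrA; apply: (@le_trans _ _ (5%:R * `|w| ^+ 2)).
    by apply: cexp_taylor1; rewrite (le_trans ws) // lecR.
  rewrite rmorphM rmorphXn /= (rmorph_nat _ 5) ler_wpM2l //.
  by apply: lerXn2r; rewrite ?nnegrE // ler0c.
apply: (@le_trans _ _ ((5 * s ^+ 2)%:C * (k.+1%:R * expR s ^+ k.+1)%:C)).
  by rewrite ler_wpM2r // ler0c mulr_ge0 // exprn_ge0 // expR_ge0.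
rewrite -rmorphM lecR -expRM_natl.
have -> : k.+1%:R * s = r by rewrite mulrC divfK // gt_eqF.
by rewrite le_eqVlt; apply/orP; left; apply/eqP; rewrite /s; field; rewrite gt_eqF.
Qed.

Lemma near_bounded T (F : set_system T) {FF : Filter F} (g : T -> C) (l : C) :
  g @ F --> l -> \forall x \near F, `|g x| <= (complex.Re `|l| + 1)%:C.
Proof.
move=> gl; move/cvgrPdist_lt : (gl) => /(_ 1 ltr01); apply: filterS => x gx.
rewrite -[g x](subrK l) addrC (le_trans (ler_normD _ _)) //.
by rewrite rmorphD /= Re_normE lerD2l distrC ltW.
Qed.

Lemma near_natr_ge T (F : set_system T) {FF : Filter F} (k : T -> nat) (M : R) :
  k @ F --> \oo -> \forall x \near F, M <= (k x)%:R.
Proof.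
move=> koo; have : \forall n \near \oo, M <= n%:R :> R by exact: nbhs_infty_ger.
by move/koo.
Qed.

(** Turns functions built from the exponential into limits of polynomial ones;
the argument and the exponent vary together, as joint limits require. *)
Lemma cvg_expn_cexp T (F : set_system T) {FF : Filter F} (g : T -> C) (k : T -> nat)
    (l : C) :
  g @ F --> l -> k @ F --> \oo ->
  (fun x => (1 + g x / (k x)%:R) ^+ (k x)) @ F --> cexp l.
Proof.
move=> gl koo.
pose r := complex.Re `|l| + 1.
have gr : \forall x \near F, `|g x| <= r%:C by exact: near_bounded gl.
apply/cvgrPdist_lt => e0 /gt0_complexP[e e_gt0 ->].
have e2 : 0 < e / 2 by rewrite divr_gt0.
have /cvgrPdist_lt/(_ (e / 2)%:C) := @cvg_cexp _ _ FF _ _ gl.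
rewrite ltcR => /(_ e2) near1.
pose B := 5 * r ^+ 2 * expR r.
have kbig M := near_natr_ge M koo.
near=> x.
have kx0 : (0 < k x)%N.
  have : 1 <= (k x)%:R :> R by near: x; exact: kbig.
  by rewrite ler1n.
have kb : `|(1 + g x / (k x)%:R) ^+ (k x) - cexp (g x)| <= (B / (k x)%:R)%:C.
  rewrite -(prednK kx0); apply: expn_cexp_bound; first by near: x.
  by rewrite prednK //; near: x; exact: kbig.
rewrite -[cexp l](subrK (cexp (g x))) -addrA.
apply: (le_lt_trans (ler_normD _ _)).
have -> : e = e / 2 + e / 2 by field.
rewrite rmorphD /=; apply: ltrD; first by near: x.
rewrite distrC (le_lt_trans kb) // ltcR ltr_pdivrMr ?ltr0n //.
rewrite -ltr_pdivrMl //; apply: (@lt_le_trans _ _ ((e / 2)^-1 * B + 1)).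
  by rewrite ltrDl.
by near: x; exact: kbig.
Unshelve. all: by end_near. Qed.

Lemma unit_cexp (v : C) : `|v| = 1 -> exists a : R, v = cexp ('i * a%:C).
Proof.
case: v => x y; rewrite normc_def /= => -[] /(congr1 (fun t => t ^+ 2)).
rewrite sqr_sqrtr ?addr_ge0 ?sqr_ge0 // expr1n => xy.
have x1 : -1 <= x <= 1 by apply/andP; split; nra.
have sn : sin (acos x) = `|y|.
  by rewrite sin_acos // -xy addrC addKr sqrtr_sqr.
have cs : cos (acos x) = x by rewrite acosK // in_itv.
have E a : cexp ('i * a%:C) = cos a +i* sin a :> C.
  by rewrite /cexp; simpc; rewrite /= expR0; simpc.
have [y0|y0] := leP 0 y.
  by exists (acos x); rewrite E cs sn ger0_norm.
by exists (- acos x); rewrite E cosN sinN cs sn ltr0_norm // opprK.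
Qed.

Lemma cexp_2pi k : cexp ('i * (k%:R * (pi *+ 2))%:C) = 1 :> C.
Proof.
rewrite rmorphM rmorph_nat /= mulrCA cexpM_natl.
have -> : cexp ('i * (pi *+ 2)%:C) = 1 :> C; last by rewrite expr1n.
by rewrite /cexp; simpc; rewrite /= expR0 cos2pi -[pi *+ 2]add0r sinD2pi sin0; simpc.
Qed.
End ComplexExp.

(** * Padé denominators *)

Lemma natr_fact_neq0 (K : numFieldType) n : n`!%:R != 0 :> K.
Proof. by rewrite pnatr_eq0 -lt0n fact_gt0. Qed.

Section Pade.
Context {R : realType}.
Local Notation C := R[i].

Definition pade_coef (K : fieldType) (N i : nat) : K :=
  ((N + N - i)`!)%:R / ((N - i)`!%:R * i`!%:R).

(** The diagonal Padé approximant of exp z of degree N is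
pade_den N z / pade_den N (- z) in this normalization, whose constant
coefficient is (2 N)! / N!; these are reverse Bessel polynomials up to
scaling. *)
Definition pade_den (N : nat) : {poly C} := \poly_(i < N.+1) pade_coef C N i.

Lemma pade_den_rec N : pade_den N.+2 =
  (2 * (2 * N + 3))%:R *: pade_den N.+1 + 'X^2 * pade_den N.
Proof.
apply/polyP => i; rewrite coefD coefZ coefXnM !coef_poly.
case: i => [|[|l]] /=.
- rewrite addr0 /pade_coef !subn0 fact0 !mulr1.
  have -> : (N.+2 + N.+2 = (N + N).+4)%N by lia.
  have -> : (N.+1 + N.+1 = (N + N).+2)%N by lia.
  rewrite !factS !natrM; field; rewrite !natr_fact_neq0 /=.
  by rewrite ?nat1r -?natrD !pnatr_eq0.
- rewrite addr0 /pade_coef (_ : 1`! = 1%N) // !mulr1.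
  have -> : (N.+2 + N.+2 - 1 = (N + N).+3)%N by lia.
  have -> : (N.+1 + N.+1 - 1 = (N + N).+1)%N by lia.
  rewrite !subSS !subn0 !factS !natrM; field; rewrite !natr_fact_neq0 /=.
  by rewrite ?nat1r -?natrD !pnatr_eq0.
rewrite !subSS !subn0 !ltnS.
have [lN|Nl] := leqP l N; last by rewrite ltnNge (ltnW Nl) /= mulr0 addr0.
have [d ->] : exists d, N = (l + d)%N by exists (N - l)%N; rewrite subnKC.
rewrite /pade_coef.
have e0 : ((l + d).+2 - l.+2 = d)%N by lia.
have e1 : ((l + d).+2 + (l + d).+2 - l.+2 = (l + d + d).+2)%N by lia.
have e2 : ((l + d).+1 + (l + d).+1 - l.+2 = l + d + d)%N by lia.
have e3 : (l + d + (l + d) - l = l + d + d)%N by lia.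
rewrite e0 e1 e2 e3 addKn.
case: d {lN e0 e1 e2 e3} => [|d].
  rewrite !addn0 ltnn mulr0 add0r !factS !natrM; field.
  by rewrite !natr_fact_neq0 ?nat1r -?natrD !pnatr_eq0.
have e4 : ((l + d.+1).+1 - l.+2 = d)%N by lia.
have -> : (l < l + d.+1)%N by lia.
rewrite e4 !factS !natrM; field.
by rewrite !natr_fact_neq0 ?nat1r -?natrD !pnatr_eq0.
Qed.

Lemma Re_pade_rec (c : R) (z q0 q1 : C) :
  complex.Re ((c%:C * q1 + z ^+ 2 * q0) * (z * q1)^*) =
  c * complex.Re z * (complex.Re q1 ^+ 2 + complex.Im q1 ^+ 2) +
  (complex.Re z ^+ 2 + complex.Im z ^+ 2) * complex.Re (q1 * (z * q0)^*).
Proof. by case: z q0 q1 => [x y] [a b] [u v]; rewrite expr2; simpc => /=; ring. Qed.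

(** With Q_N = pade_den N, the quotient Q_{N+1} / (z Q_N) has positive real part.
The recurrence writes Q_{N+2} / (z Q_{N+1}) as 2 (2 N + 3) / z plus the inverse
of that quotient, and the right half plane is stable under sums and inverses.
Real parts of products with a conjugate avoid dividing by Q_N. *)
Lemma pade_den_pos (z : C) N : z != 0 -> 0 <= complex.Re z ->
  0 < complex.Re ((pade_den N.+1).[z] * (z * (pade_den N).[z])^*).
Proof.
move=> z0 Rez.
have nz : 0 < complex.Re z ^+ 2 + complex.Im z ^+ 2.
  by rewrite -ltcR add_Re2_Im2 exprn_gt0 // normr_gt0.
elim: N => [|N IH].
  have c00 : pade_coef C 0 0 = 1 by rewrite /pade_coef !fact0 mulr1 divr1.
  have c10 : pade_coef C 1 0 = 2.
    rewrite /pade_coef (_ : (1 + 1 - 0)`! = 2%N) // (_ : (1 - 0)`! = 1%N) //.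
    by rewrite fact0 mulr1 divr1.
  have c11 : pade_coef C 1 1 = 1.
    by rewrite /pade_coef (_ : (1 + 1 - 1)`! = 1%N) // (_ : (1 - 1)`! = 1%N).
  rewrite !horner_poly big_ord_recl !big_ord1 /= c00 c10 c11 !expr0 expr1 !mulr1 mul1r.
  case: z z0 Rez nz => x y _ /= x0 nz.
  nra.
rewrite pade_den_rec hornerD hornerZ hornerM hornerXn.
rewrite -(rmorph_nat (real_complex R)) Re_pade_rec.
apply: ltr_wpDl; last by rewrite mulr_gt0.
by rewrite !mulr_ge0 // addr_ge0 // sqr_ge0.
Qed.

Lemma pade_den_neq0 N (z : C) : 0 <= complex.Re z -> (pade_den N).[z] != 0.
Proof.
move=> Rez; have [->|z0] := eqVneq z 0.
  rewrite horner_coef0 coef_poly /pade_coef subn0 fact0 mulr1.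
  by rewrite mulf_neq0 ?invr_eq0 ?natr_fact_neq0.
apply: contraTneq (pade_den_pos N z0 Rez) => ->.
by rewrite mulr0 rmorph0 mulr0 ltxx.
Qed.

Lemma conjc_pade_den N (z : C) : ((pade_den N).[z])^* = (pade_den N).[z^*].
Proof.
rewrite !horner_poly rmorph_sum; apply: eq_bigr => i _.
by rewrite rmorphM rmorphXn /= /pade_coef rmorphM fmorphV rmorphM !rmorph_nat.
Qed.

(** All roots c lie in the open left half plane, so z is at least as far from c
as its mirror image - z^* is. *)
Lemma pade_den_contract N (z : C) : 0 <= complex.Re z ->
  `|(pade_den N).[- z]| <= `|(pade_den N).[z]|.
Proof.
move=> Rez; rewrite -[leLHS]norm_conjC conjc_pade_den.
have [rs pE] := closed_field_poly_normal (pade_den N).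
have pz w : `|(pade_den N).[w]| = `|lead_coef (pade_den N)| * \prod_(c <- rs) `|w - c|.
  rewrite {1}pE hornerZ normrM horner_prod normr_prod; congr (_ * _).
  by apply: eq_bigr => c _; rewrite hornerXsubC.
rewrite !pz ler_wpM2l // big_seq [leRHS]big_seq; apply: ler_prod => c crs.
rewrite normr_ge0 /=.
have Rec : complex.Re c < 0.
  rewrite ltNge; apply/negP => /(pade_den_neq0 N)/negP; apply.
  have /rootP cp : root (\prod_(z <- rs) ('X - z%:P)) c by rewrite root_prod_XsubC.
  by rewrite pE hornerZ cp mulr0.
rewrite -(@ler_pXn2r _ 2) ?nnegrE // -!add_Re2_Im2 lecR.
by case: z c Rez Rec {crs} => [x y] [a b] /= x0 a0; nra.
Qed.
End Pade.

(** * Convergence of the Padé approximants *)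

Section PadeLimit.
Context {R : realType}.
Local Notation C := R[i].

(** Coefficients, multiplied by i!, of the normalized polynomial
pade_den N z * N! / (2 N)!, which tends to exp (z / 2). *)
Definition pade_ratio (N i : nat) : R :=
  N`!%:R * (N + N - i)`!%:R / ((N + N)`!%:R * (N - i)`!%:R).

(** Coefficients, multiplied by i!, of (1 + z / (2 N)) ^ N, which has the same
limit. *)
Definition power_ratio (N i : nat) : R :=
  N`!%:R / ((N - i)`!%:R * (N + N)%:R ^+ i).

Lemma pade_ratioS N i : (i < N)%N ->
  pade_ratio N i.+1 = pade_ratio N i * ((N - i)%:R / (N + N - i)%:R).
Proof.
move=> iN; rewrite /pade_ratio.
have -> : (N + N - i = (N + N - i.+1).+1)%N by lia.
have -> : (N - i = (N - i.+1).+1)%N by lia.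
rewrite !factS !natrM; field; rewrite !natr_fact_neq0 /=.
by rewrite ?nat1r -?natrD !pnatr_eq0.
Qed.

Lemma power_ratioS N i : (i < N)%N ->
  power_ratio N i.+1 = power_ratio N i * ((N - i)%:R / (N + N)%:R).
Proof.
move=> iN; rewrite /power_ratio exprS.
have -> : (N - i = (N - i.+1).+1)%N by lia.
rewrite !factS !natrM; field; rewrite !natr_fact_neq0 /=.
have N0 : (N + N)%:R != 0 :> R by rewrite pnatr_eq0; lia.
by rewrite expf_neq0 //= ?nat1r -?natrD !pnatr_eq0; lia.
Qed.

(** Both sequences start at 1 and are multiplied at step i by (N - i) / (2 N - i)
and (N - i) / (2 N).  These factors lie in [0, 1] and differ by at most
i / (2 N), so the gap grows by at most that amount at each step. *)
Lemma pade_ratio_bound N i : (0 < N)%N -> (i <= N)%N ->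
  [/\ 0 <= pade_ratio N i <= 1, power_ratio N i <= pade_ratio N i &
      pade_ratio N i - power_ratio N i <= (i ^ 2)%:R / (N + N)%:R].
Proof.
move=> N0; elim: i => [_|i IH iN].
  have -> : pade_ratio N 0 = 1.
    by rewrite /pade_ratio !subn0 [X in X / _]mulrC divff // mulf_neq0.
  have -> : power_ratio N 0 = 1 by rewrite /power_ratio subn0 mulr1 divff.
  by rewrite ler01 lexx subrr mul0r lexx.
have [/andP[b0 b1] pb bp] := IH (ltnW iN).
rewrite pade_ratioS // power_ratioS //.
set b := pade_ratio N i in b0 b1 pb bp *; set p := power_ratio N i in pb bp *.
have N0' : 0 < (N + N)%:R :> R by rewrite ltr0n; lia.
have NNi : (N + N - i <= N + N)%N by exact: leq_subr.
have NiN : (N - i <= N + N - i)%N by lia.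
have NiN' : (N - i <= N + N)%N by lia.
have Ni : 0 < (N + N - i)%:R :> R by rewrite ltr0n; lia.
have x0 : 0 <= (N - i)%:R / (N + N - i)%:R :> R by rewrite divr_ge0.
have x1 : (N - i)%:R / (N + N - i)%:R <= 1 :> R by rewrite ler_pdivrMr // mul1r ler_nat.
have y0 : 0 <= (N - i)%:R / (N + N)%:R :> R by rewrite divr_ge0.
have y1 : (N - i)%:R / (N + N)%:R <= 1 :> R by rewrite ler_pdivrMr // mul1r ler_nat.
have xy : (N - i)%:R / (N + N)%:R <= (N - i)%:R / (N + N - i)%:R :> R.
  by rewrite ler_wpM2l // lef_pV2 ?posrE // ler_nat.
have yx : (N - i)%:R / (N + N - i)%:R - (N - i)%:R / (N + N)%:R <=
    i%:R / (N + N)%:R :> R.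
  have -> : (N - i)%:R / (N + N - i)%:R - (N - i)%:R / (N + N)%:R =
      (N - i)%:R / (N + N - i)%:R * (i%:R / (N + N)%:R) :> R.
    have iE : i%:R = (N + N)%:R - (N + N - i)%:R :> R.
      by rewrite -natrB ?leq_subr // subKn // (leq_trans (ltnW iN)) ?leq_addr.
    rewrite iE; move: N0' Ni; move: (N + N)%:R (N + N - i)%:R (N - i)%:R => u v w u0 v0.
    by field; rewrite !gt_eqF.
  by rewrite ler_piMl // divr_ge0.
set x := _ / (N + N - i)%:R in x0 x1 xy yx *; set y := (N - i)%:R / _ in y0 y1 xy yx *.
split.
- by rewrite mulr_ge0 //= mulr_ile1.
- exact: le_trans (ler_wpM2r y0 pb) (ler_wpM2l b0 xy).
- have -> : (i.+1 ^ 2)%:R / (N + N)%:R =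
      (i ^ 2)%:R / (N + N)%:R + i%:R / (N + N)%:R + i.+1%:R / (N + N)%:R :> R.
    rewrite -!mulrDl -!natrD; congr (_%:R / _); clear.
    by rewrite -[i.+1]addn1 sqrnD muln1 exp1n; lia.
  have i0 : 0 <= i.+1%:R / (N + N)%:R :> R by rewrite divr_ge0.
  have -> : b * x - p * y = (b - p) * y + b * (x - y) by ring.
  have h1 : (b - p) * y <= b - p by rewrite ler_piMr // subr_ge0.
  have h2 : b * (x - y) <= x - y by rewrite ler_piMl // subr_ge0.
  lra.
Qed.

(** The weights i ^ 2 of the previous bound are absorbed by i ^ 2 <= 4 ^ i, and
a further factor 2 ^ i makes the sum over i a geometric one. *)
Lemma exp_term_bound (r : R) i : 0 <= r ->
  (i ^ 2)%:R * r ^+ i / i`!%:R <= (1 / 2) ^+ i * expR (8 * r).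
Proof.
move=> r0.
have i4 : (i ^ 2)%:R <= 4%:R ^+ i :> R.
  rewrite -natrX ler_nat (_ : 4 = 2 ^ 2)%N // -expnM mulnC expnM leq_exp2r //.
  by rewrite ltnW // ltn_expl.
apply: (@le_trans _ _ (4%:R ^+ i * r ^+ i / i`!%:R)).
  by rewrite ler_wpM2r ?invr_ge0 // ler_wpM2r // exprn_ge0.
have -> : 4%:R ^+ i * r ^+ i / i`!%:R = (1 / 2) ^+ i * ((8 * r) ^+ i / i`!%:R).
  by rewrite mulrA -!exprMn; congr (_ ^+ _ / _); field.
rewrite ler_wpM2l ?exprn_ge0 //; case: i {i4} => [|i].
  by rewrite expr0 fact0 divr1 -[1]expR0 ler_expR mulr_ge0.
have r8 : 0 <= 8 * r by rewrite mulr_ge0.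
by have := expR_ge1Dxn i r8; lra.
Qed.

Lemma geometric_half_le n : \sum_(i < n.+1) (1 / 2 : R) ^+ i <= 2.
Proof.
suff -> : \sum_(i < n.+1) (1 / 2 : R) ^+ i = 2 - (1 / 2) ^+ n.
  by rewrite lerBlDr lerDl exprn_ge0.
elim: n => [|n IH]; first by rewrite big_ord1 !expr0; ring.
by rewrite big_ord_recr /= IH exprS; field.
Qed.

Lemma pade_den_power_bound N (z : C) (r : R) : (0 < N)%N -> `|z| <= r%:C ->
  `|(pade_den N).[z] * (N`!%:R / (N + N)`!%:R) - (1 + z / 2 / N%:R) ^+ N|
    <= (expR (8 * r) / N%:R)%:C.
Proof.
move=> N0 zr; have r0 : 0 <= r by rewrite -ler0c (le_trans _ zr).
have N1 : N%:R != 0 :> C by rewrite pnatr_eq0 -lt0n.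
have -> : (pade_den N).[z] * (N`!%:R / (N + N)`!%:R) =
    \sum_(i < N.+1) (pade_ratio N i / i`!%:R)%:C * z ^+ i.
  rewrite horner_poly mulr_suml; apply: eq_bigr => i _.
  rewrite mulrAC; congr (_ * _); rewrite /pade_coef /pade_ratio.
  rewrite !(rmorphM, fmorphV, rmorph_nat) /=; field.
  by rewrite !natr_fact_neq0.
have -> : (1 + z / 2 / N%:R) ^+ N =
    \sum_(i < N.+1) (power_ratio N i / i`!%:R)%:C * z ^+ i.
  rewrite exprDn; apply: eq_bigr => i _.
  rewrite expr1n mul1r -mulr_natr.
  have -> : 'C(N, i)%:R = N`!%:R / (i`!%:R * (N - i)`!%:R) :> C.
    apply: (canRL (mulfK _)); first by rewrite mulf_neq0.
    by rewrite -natrM -natrM bin_fact // -ltnS.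
  rewrite /power_ratio !(rmorphM, fmorphV, rmorph_nat, rmorphXn) /=.
  have NN0 : (N + N)%:R != 0 :> C by rewrite pnatr_eq0; lia.
  have -> : z / 2 / N%:R = z * (N + N)%:R^-1.
    by rewrite natrD in NN0 *; field; rewrite N1 NN0.
  rewrite exprMn exprVn; move: (N + N)%:R NN0 => u u0; field.
  by rewrite !natr_fact_neq0 /= expf_neq0.
rewrite -sumrB; apply: (le_trans (ler_norm_sum _ _ _)).
apply: (@le_trans _ _
    (\sum_(i < N.+1) ((1 / 2) ^+ i * (expR (8 * r) / (N + N)%:R))%:C)).
  apply: ler_sum => i _; rewrite -mulrBl -rmorphB normrM norm_real_complex normrX.
  have [|_ b1 b2] := @pade_ratio_bound N i N0; first by rewrite -ltnS.
  apply: (@le_trans _ _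
      (`|pade_ratio N i / i`!%:R - power_ratio N i / i`!%:R|%:C * r%:C ^+ i)).
    apply: ler_wpM2l; first by rewrite ler0c.
    by apply: lerXn2r; rewrite ?nnegrE // ler0c.
  rewrite -rmorphXn -rmorphM lecR -mulrBl ger0_norm; last first.
    by rewrite mulr_ge0 ?invr_ge0 // subr_ge0.
  apply: (@le_trans _ _ ((i ^ 2)%:R / (N + N)%:R / i`!%:R * r ^+ i)).
    by rewrite ler_wpM2r ?exprn_ge0 // ler_wpM2r // invr_ge0.
  have := exp_term_bound i r0.
  rewrite -(@ler_pM2r _ (N + N)%:R^-1) ?invr_gt0 ?ltr0n ?addn_gt0 ?N0 // => h.
  by apply: le_trans (le_trans _ h) _; rewrite le_eqVlt; apply/orP; left; apply/eqP; ring.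
rewrite -rmorph_sum lecR -mulr_suml.
apply: (@le_trans _ _ (2 * (expR (8 * r) / (N + N)%:R))).
  by rewrite ler_wpM2r ?geometric_half_le // divr_ge0 // expR_ge0.
rewrite le_eqVlt; apply/orP; left; apply/eqP; rewrite natrD; field.
by rewrite -natrD !pnatr_eq0; lia.
Qed.

(** The comparison with (1 + z / (2 N)) ^ N replaces a dominated convergence
argument on the coefficients. *)
Lemma cvg_pade_den T (F : set_system T) {FF : Filter F} (k : T -> nat) (g : T -> C)
    (l : C) :
  k @ F --> \oo -> g @ F --> l ->
  (fun x => (pade_den (k x)).[g x] * ((k x)`!%:R / (k x + k x)`!%:R)) @ F --> cexp (l / 2).
Proof.
move=> koo gl; pose r := complex.Re `|l| + 1.
have gr : \forall x \near F, `|g x| <= r%:C by exact: near_bounded gl.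
have g2 : (fun x => g x / 2) @ F --> l / 2 by exact: (cvgM gl (cvg_cst _)).
have pow := @cvg_expn_cexp _ _ _ FF _ _ _ g2 koo.
apply/cvgrPdist_lt => e0 /gt0_complexP[e e_gt0 ->].
have e2 : 0 < e / 2 by rewrite divr_gt0.
move/cvgrPdist_lt : pow => /(_ (e / 2)%:C); rewrite ltcR => /(_ e2) near1.
pose B := expR (8 * r).
have kbig M := near_natr_ge M koo.
near=> x.
have kx0 : (0 < k x)%N.
  have : 1 <= (k x)%:R :> R by near: x; exact: kbig.
  by rewrite ler1n.
have gx : `|g x| <= r%:C by near: x.
have kb := pade_den_power_bound kx0 gx.
have nx : `|cexp (l / 2) - (1 + g x / 2 / (k x)%:R) ^+ k x| < (e / 2)%:C by near: x.
move: kb nx; set a := (pade_den _).[_] * _; set b := (1 + _) ^+ _ => kb nx.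
rewrite -[cexp _](subrK b) -addrA (le_lt_trans (ler_normD _ _)) //.
have -> : e = e / 2 + e / 2 by field.
rewrite rmorphD /=; apply: (ltrD nx).
rewrite distrC (le_lt_trans kb) // ltcR ltr_pdivrMr ?ltr0n //.
rewrite -ltr_pdivrMl //; apply: (@lt_le_trans _ _ ((e / 2)^-1 * B + 1)).
  by rewrite ltrDl.
by near: x; exact: kbig.
Unshelve. all: by end_near. Qed.

(** The diagonal Padé approximant of exp (- z). *)
Definition pade (N : nat) (z : C) : C := (pade_den N).[- z] / (pade_den N).[z].

Lemma norm_pade_le1 N (z : C) : 0 <= complex.Re z -> `|pade N z| <= 1.
Proof.
move=> z0; rewrite normrM normfV ler_pdivrMr ?normr_gt0 ?pade_den_neq0 //.
by rewrite mul1r pade_den_contract.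
Qed.

Lemma cvg_pade T (F : set_system T) {FF : Filter F} (k : T -> nat) (g : T -> C) (l : C) :
  k @ F --> \oo -> g @ F --> l -> (fun x => pade (k x) (g x)) @ F --> cexp (- l).
Proof.
move=> koo gl.
have -> : cexp (- l) = cexp (- l / 2) / cexp (l / 2).
  by apply: (canRL (mulfK (cexp_neq0 _))); rewrite -cexpD; congr cexp; field.
have -> : (fun x => pade (k x) (g x)) = (fun x =>
    ((pade_den (k x)).[- g x] * ((k x)`!%:R / (k x + k x)`!%:R)) /
    ((pade_den (k x)).[g x] * ((k x)`!%:R / (k x + k x)`!%:R))).
  have cancel_c (a b c : C) : c != 0 -> a / b = (a * c) / (b * c).
    by move=> c0; rewrite -mulf_div divff // mulr1.
  by apply/funext => x; apply: cancel_c; rewrite mulf_neq0 ?invr_neq0 // natr_fact_neq0.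
have c1 := @cvg_pade_den _ _ FF _ _ _ koo gl.
have gNl : (fun x => - g x) @ F --> - l by exact: (cvgN gl).
have c2 := @cvg_pade_den _ _ FF _ _ _ koo gNl.
exact: (cvgM c2 (cvgV (cexp_neq0 _) c1)).
Qed.
End PadeLimit.

(** * Characteristic pencil at infinity *)

Section Pencil.
Context {R : realType}.
Local Notation C := R[i].
Context {n m : nat} (E A0 : 'M[C]_n) (A : 'I_m.+1 -> 'M[C]_n).
Implicit Types (s x : C) (w : 'I_m.+1 -> C).

Definition char_pencil s w : 'M[C]_n := s *: E - A0 - \sum_k w k *: A k.

(** The condition that the compression of A0 to the kernel of E and the
cokernel of E is injective, stated without a choice of bases. *)
Definition index_le1 : Prop := forall x : 'cV[C]_n, E *m x = 0 ->
  (forall u : 'rV[C]_n, u *m E = 0 -> u *m A0 *m x = 0) -> x = 0.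

Let rk := \rank E.
Let L := invmx (col_ebase E).
Let U := invmx (row_ebase E).

Definition reduced_mx w : 'M[C]_n := L *m (A0 + \sum_k w k *: A k) *m U.

(** Determinant of the pencil at frequency x + 1 / s, after an equivalence that
brings E to diag (1, 0) and a multiplication by s of the first rank (E) rows.
It is polynomial in all its arguments, in particular defined at s = 0, the
frequency infinity, where x disappears; this makes s -> 0 an ordinary limit. *)
Definition scaled_det s x w : C :=
  \det ((1 + s * x) *: (pid_mx rk : 'M[C]_n)
        - (s *: pid_mx rk + copid_mx rk) *m reduced_mx w).

Let P : 'M[C]_n := pid_mx rk.
Let Q : 'M[C]_n := copid_mx rk.
Let pidK : P *m P = P.
Proof. by rewrite /P pid_mx_id // rank_leq_row. Qed.
Let copidpid : Q *m P = 0.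
Proof. by rewrite /Q mulmxBl mul1mx pidK subrr. Qed.
Let pidcopid : P *m Q = 0.
Proof. by rewrite /Q mulmxBr mulmx1 pidK subrr. Qed.
Let copidK : Q *m Q = Q.
Proof. by rewrite {1}/Q mulmxBl mul1mx pidcopid subr0. Qed.
Let PQ1 : P + Q = 1%:M.
Proof. by rewrite /Q /copid_mx addrC subrK. Qed.
Let LE : L *m E *m U = P.
Proof.
rewrite -{1}[E]mulmx_ebase !mulmxA mulVmx ?col_ebase_unit // mul1mx.
by rewrite -mulmxA mulmxV ?row_ebase_unit // mulmx1.
Qed.

Lemma scaled_det_eq0 s x w : s != 0 ->
  (scaled_det s x w == 0) = (\det (char_pencil (x + s^-1) w) == 0).
Proof.
move=> s0; pose D : 'M[C]_n := s *: P + Q.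
have DD : D *m (s^-1 *: P + Q) = 1%:M.
    rewrite /D; move: PQ1 pidK copidpid pidcopid copidK.
    move: P Q => p q pq pp qp pq0 qq.
    rewrite mulmxDl !mulmxDr -!scalemxAl -!scalemxAr pp qp pq0 qq.
    by rewrite scalerA mulfV // scale1r !scaler0 addr0 add0r.
have [uD _] := mulmx1_unit DD.
have -> : scaled_det s x w = \det (D *m (L *m char_pencil (x + s^-1) w *m U)).
  rewrite [LHS](_ : _ = \det ((1 + s * x) *: P - D *m reduced_mx w)) //.
  congr (\det _); rewrite /char_pencil -addrA -opprD mulmxBr mulmxBl mulmxBr.
  congr (_ - _); rewrite -scalemxAr -scalemxAl LE -scalemxAr /D.
  move: pidK copidpid; move: P Q => p q pp qp.
  by rewrite mulmxDl -scalemxAl pp qp addr0 scalerA mulrDl mulVf // addrC [x * s]mulrC.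
rewrite !det_mulmx !mulf_eq0.
have du (M : 'M[C]_n) : M \in unitmx -> (\det M == 0) = false.
  by rewrite unitmxE unitfE => /negbTE.
by rewrite (du D) // (du L) ?(du U) ?unitmx_inv ?col_ebase_unit ?row_ebase_unit // orbF.
Qed.

(** At s = 0 and w = 0 the matrix is block triangular, with the identity and
the compression of - A0 on the diagonal, and the latter is injective by the
index condition. *)
Lemma scaled_det0_neq0 x : index_le1 -> scaled_det 0 x (fun=> 0) != 0.
Proof.
move=> idx; rewrite /scaled_det -/P -/Q mul0r addr0 scale1r scale0r add0r.
set N := (X in \det X); rewrite -det_tr -unitfE -unitmxE -row_free_unit.
apply: inj_row_free => v /(congr1 trmx); rewrite trmx_mul trmxK trmx0.
move=> Nv; apply: trmx_inj; rewrite trmx0; move: (v^T) Nv => {v} y Ny.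
have M0 : reduced_mx (fun=> 0) = L *m A0 *m U.
  by rewrite /reduced_mx big1 ?addr0 // => k _; rewrite scale0r.
have y1 : P *m y = 0.
  by have := congr1 (mulmx (P)) Ny; rewrite mulmx0 !mulmxA mulmxBr pidK
    mulmxA pidcopid mul0mx subr0.
have y2 : Q *m (L *m A0 *m U) *m y = 0.
  by move: Ny; rewrite /N mulmxBl y1 sub0r M0 => /eqP; rewrite oppr_eq0 => /eqP.
suff : U *m y = 0.
  move/(congr1 (mulmx (row_ebase E))); rewrite mulmxA mulmxV ?row_ebase_unit //.
  by rewrite mul1mx mulmx0.
apply: idx => [|u uE].
  rewrite -[E]mulmx_ebase -!mulmxA (mulmxA (row_ebase E)) mulmxV ?row_ebase_unit //.
  by rewrite mul1mx y1 mulmx0.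
pose u' := u *m col_ebase E.
have u'pid : u' *m P = 0.
  rewrite -LE /u' !mulmxA -(mulmxA u) mulmxV ?col_ebase_unit // mulmx1 uE.
  by rewrite mul0mx.
have u'E : u' = u' *m Q by rewrite /Q mulmxBr mulmx1 u'pid subr0.
have -> : u = u' *m L by rewrite -mulmxA mulmxV ?col_ebase_unit // mulmx1.
by have := congr1 (mulmx u') y2; rewrite mulmx0 !mulmxA -u'E.
Qed.

Lemma scaled_det0_shift x y w : scaled_det 0 x w = scaled_det 0 y w.
Proof. by rewrite /scaled_det !mul0r. Qed.

Lemma cvg_scaled_det T (F : set_system T) {FF : Filter F} (s x : T -> C)
    (w : T -> 'I_m.+1 -> C) (s0 x0 : C) (w0 : 'I_m.+1 -> C) :
  s @ F --> s0 -> x @ F --> x0 -> (forall k, (fun t => w t k) @ F --> w0 k) ->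
  (fun t => scaled_det (s t) (x t) (w t)) @ F --> scaled_det s0 x0 w0.
Proof.
move=> cs cx cw; apply: cvg_det => i j.
have Ecst p q (M : 'M[C]_(p, q)) a b : (fun=> M a b) @ F --> M a b by exact: cvg_cst.
have EZ p q (f : T -> C) (l : C) (M : 'M[C]_(p, q)) a b : f @ F --> l ->
    (fun t => (f t *: M) a b) @ F --> (l *: M) a b.
  move=> fl; rewrite mxE; under eq_fun do rewrite mxE.
  exact: (cvgM fl (cvg_cst _)).
have ED p q (M1 M2 : T -> 'M[C]_(p, q)) (N1 N2 : 'M[C]_(p, q)) :
    (forall a b, (fun t => M1 t a b) @ F --> N1 a b) ->
    (forall a b, (fun t => M2 t a b) @ F --> N2 a b) ->
    forall a b, (fun t => (M1 t + M2 t) a b) @ F --> (N1 + N2) a b.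
  move=> c1 c2 a b; rewrite mxE; under eq_fun do rewrite mxE.
  exact: (cvgD (c1 a b) (c2 a b)).
have EN p q (M1 : T -> 'M[C]_(p, q)) (N1 : 'M[C]_(p, q)) :
    (forall a b, (fun t => M1 t a b) @ F --> N1 a b) ->
    forall a b, (fun t => (- M1 t) a b) @ F --> (- N1) a b.
  move=> c1 a b; rewrite mxE; under eq_fun do rewrite mxE.
  exact: (cvgN (c1 a b)).
have Esum a b : (fun t => (\sum_k w t k *: A k) a b) @ F --> (\sum_k w0 k *: A k) a b.
  rewrite summxE; under eq_fun do rewrite summxE.
  by apply: cvg_sumc => k _; exact: (EZ _ _ _ _ _ a b (cw k)).
have c1s : (fun t => 1 + s t * x t) @ F --> 1 + s0 * x0.
  exact: (cvgD (cvg_cst _) (cvgM cs cx)).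
apply: (@ED) => [a b|]; first exact: (EZ _ _ _ _ _ a b c1s).
apply: (@EN); apply: cvg_mulmx.
  apply: (@ED) => a b; first exact: (EZ _ _ _ _ _ a b cs).
  exact: (Ecst _ _ (copid_mx rk) a b).
apply: cvg_mulmx => [|a b]; last exact: (Ecst _ _ U a b).
apply: cvg_mulmx => [a b|]; first exact: (Ecst _ _ L a b).
by apply: (@ED) => a b; [exact: (Ecst _ _ A0 a b)|exact: Esum].
Qed.

Lemma polyfun_scaled_det s (x : C -> C) (w : C -> 'I_m.+1 -> C) :
  polyfun x -> (forall k, polyfun (fun z => w z k)) ->
  polyfun (fun z => scaled_det s (x z) (w z)).
Proof.
move=> px pw; apply: polyfun_det => i j.
have Ecst p q (M : 'M[C]_(p, q)) a b : polyfun (fun=> M a b) by exact: polyfun_cst.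
have EZ p q (f : C -> C) (M : 'M[C]_(p, q)) a b : polyfun f ->
    polyfun (fun t => (f t *: M) a b).
  by move=> pf; apply: eq_polyfun (polyfunM pf (polyfun_cst (M a b))) => z; rewrite mxE.
have ED p q (M1 M2 : C -> 'M[C]_(p, q)) : (forall a b, polyfun (fun t => M1 t a b)) ->
    (forall a b, polyfun (fun t => M2 t a b)) ->
    forall a b, polyfun (fun t => (M1 t + M2 t) a b).
  by move=> c1 c2 a b; apply: eq_polyfun (polyfunD (c1 a b) (c2 a b)) => z; rewrite mxE.
have EN p q (M1 : C -> 'M[C]_(p, q)) : (forall a b, polyfun (fun t => M1 t a b)) ->
    forall a b, polyfun (fun t => (- M1 t) a b).
  move=> c1 a b; apply: eq_polyfun (polyfunM (polyfun_cst (- 1)) (c1 a b)) => z.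
  by rewrite mxE mulN1r.
have Esum a b : polyfun (fun t => (\sum_k w t k *: A k) a b).
  apply: (@eq_polyfun R _ (fun t => \sum_k (w t k *: A k) a b)) => [z|].
    by rewrite summxE.
  by apply: polyfun_sum => k _; exact: EZ.
apply: (@ED) => [a b|].
  apply: EZ; apply: polyfunD; first exact: polyfun_cst.
  by apply: polyfunM; first exact: polyfun_cst.
apply: (@EN); apply: polyfun_mulmx => [a b|]; first exact: Ecst.
apply: polyfun_mulmx => [|a b]; last exact: Ecst.
apply: polyfun_mulmx => [a b|]; first exact: Ecst.
by apply: (@ED) => a b; [exact: Ecst|exact: Esum].
Qed.

End Pencil.

(** * Absence of zeros on the polydisc *)

Section Polydisc.
Context {R : realType}.
Local Notation C := R[i].
Context {n m : nat} (E A0 : 'M[C]_n) (A : 'I_m.+1 -> 'M[C]_n).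
Context (tau : 'I_m.+1 -> R) (eps delta : R).
Hypothesis idx : index_le1 E A0.
Hypothesis eps_gt0 : 0 < eps.
Hypothesis delta_gt0 : 0 < delta.
Hypothesis tau_gt0 : forall k, 0 < tau k.
Hypothesis stab : forall theta : 'I_m.+1 -> R,
  (forall k, `|theta k - tau k| < delta) -> forall s : C, - eps <= complex.Re s ->
  \det (char_pencil E A0 A s (fun k => cexp (- ((theta k)%:C * s)))) != 0.

Lemma cexp_real (r : R) : cexp r%:C = (expR r)%:C :> C.
Proof. by rewrite /cexp /= cos0 sin0 mulr1. Qed.

(** Strong stability covers the nearby rational delays, for which all the
exponentials are powers of a single one. *)
Lemma rational_delays : exists M : nat, exists nn : 'I_m.+1 -> nat,
  (0 < M)%N /\ forall k, (0 < nn k)%N /\ `|(nn k)%:R / M%:R - tau k| < delta.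
Proof.
pose M := (Num.trunc delta^-1).+1.
have M0 : 0 < M%:R :> R by rewrite ltr0n.
have Md : M%:R^-1 < delta by rewrite invf_plt ?posrE //; exact: truncnS_gt.
exists M, (fun k => (Num.trunc (tau k * M%:R)).+1); split=> // k; split=> //.
have /truncn_itv/andP[x1 x2] : 0 <= tau k * M%:R by rewrite mulr_ge0 // ltW.
have t1 : tau k < (Num.trunc (tau k * M%:R)).+1%:R / M%:R by rewrite ltr_pdivlMr.
rewrite gtr0_norm ?subr_gt0 //; apply: le_lt_trans Md.
by rewrite lerBlDr ler_pdivrMr // mulrDl mulVf ?lt0r_neq0 // -natr1 addrC lerD2l.
Qed.

Let G := scaled_det E A0 A 0 0.

Let G0 : G (fun=> 0) != 0. Proof. exact: scaled_det0_neq0. Qed.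

Section RationalDelays.
Variables (M : nat) (nn : 'I_m.+1 -> nat).
Hypothesis M_gt0 : (0 < M)%N.
Hypothesis nn_gt0 : forall k, (0 < nn k)%N.
Hypothesis nn_near : forall k, `|(nn k)%:R / M%:R - tau k| < delta.

(** A Hurwitz argument.  Suppose that G vanishes at v_k t ^ n_k, and let
t = exp (- sg / M).  Then g x = G (v_k exp (- x n_k / M)) has the zero sg, which
is isolated, and g is the limit of the functions h_i obtained from the pencil
at frequency x + i omega_i, with the delays th' i k for which
exp (- i omega_i th' i k) is v_k.  By strong stability these have
no zero near sg, hence satisfy the minimum principle, and so does g: on a circle
around sg it would vanish somewhere. *)
Lemma torus_neq0 (t : R) (v : 'I_m.+1 -> C) : 0 < t <= 1 ->
  (forall k, `|v k| = 1) -> G (fun k => v k * t%:C ^+ nn k) != 0.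
Proof.
move=> /andP[t0 t1] v1; apply/eqP => Gt.
pose th k : R := (nn k)%:R / M%:R.
have M0 : 0 < M%:R :> R by rewrite ltr0n.
have MC0 : M%:R != 0 :> C by rewrite pnatr_eq0 -lt0n.
pose sg : R := - (M%:R * ln t).
have sg0 : 0 <= sg by rewrite oppr_ge0 mulr_ge0_le0 ?ln_le0 // ltW.
have /choice[al vE] : forall k, exists a : R, v k = cexp ('i * a%:C).
  by move=> k; exact: unit_cexp.
pose q y := G (fun k => v k * y ^+ nn k).
have qpoly : polyfun q.
  apply: polyfun_scaled_det => [|k]; first exact: polyfun_cst.
  by apply: polyfunM; [exact: polyfun_cst|apply: polyfunX; exact: polyfun_id].
have q0 : q 0 != 0.
  rewrite /q (_ : (fun k => _) = fun=> 0) //; apply/funext => k.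
  by rewrite expr0n eqn0Ngt nn_gt0 mulr0.
pose g x := q (cexp (- x / M%:R)).
have cexp_sg : cexp (- sg%:C / M%:R) = t%:C.
  rewrite -(rmorph_nat (real_complex R)) -rmorphN -fmorphV -rmorphM cexp_real.
  by rewrite opprK mulrAC divff ?mul1r ?lnK ?posrE // lt0r_neq0.
have gsg : g sg%:C = 0 by rewrite /g cexp_sg.
have expo_cvg : cexp (- x / M%:R) @[x --> (sg%:C : C)] --> t%:C.
  have cN : (fun x : C => - x) @ nbhs (sg%:C : C) --> - sg%:C.
    by exact: (@cvgN _ _ _ (nbhs (sg%:C : C)) _ id _ cvg_id).
  have cD : (fun x : C => - x / M%:R) @ nbhs (sg%:C : C) --> - sg%:C / M%:R.
    exact: (cvgM cN (cvg_cst _)).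
  by rewrite -cexp_sg; exact: (cvg_cexp cD).
have [e1 e1_gt0 e1P] := near_norm_ball (expo_cvg _ (polyfun_isolated_zero t%:C qpoly q0)).
(* The circle stays in the region Re x >= - eps, in the neighbourhood where
t is the only zero of q that exp (- x / M) can meet, and within a distance of
sg on which exp (- x / M) takes the value t only at sg. *)
pose r := Num.min eps (Num.min (e1 / 2) (1 / 10)).
have r0 : 0 < r by rewrite !lt_min eps_gt0 divr_gt0 //= divr_gt0.
have r1 : r <= eps by rewrite ge_min lexx.
have r2 : r < e1.
  have : r <= e1 / 2 by rewrite !ge_min lexx orbT.
  by move/le_lt_trans; apply; rewrite ltr_pdivrMr // mulr_natr mulr2n ltrDl.
have r3 : r <= 1 / 10 by rewrite !ge_min lexx !orbT.
have gcirc x : `|x - sg%:C| = r%:C -> g x != 0.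
  move=> xr; have := e1P x; rewrite xr ltcR => /(_ r2); apply.
  have -> : cexp (- x / M%:R) = t%:C * cexp (- (x - sg%:C) / M%:R).
    by rewrite -cexp_sg -cexpD; congr cexp; field.
  rewrite -[X in _ != X]mulr1 (inj_eq (mulfI _)); last by rewrite -cexp_sg cexp_neq0.
  apply: cexp_neq1.
    by rewrite mulf_neq0 ?invr_eq0 // oppr_eq0 -normr_gt0 xr ltcR.
  rewrite normrM normrN xr normfV normr_nat ltr_pdivrMr ?ltr0n //.
  rewrite -(rmorph_nat (real_complex R)) -rmorphM ltcR.
  have M1 : 1 <= M%:R :> R by rewrite ler1n.
  by lra.
(* The frequencies om i are multiples of 2 pi M, so that the unperturbed phases
om i * n_k / M are multiples of 2 pi. *)
pose c : R := pi *+ 2 * M%:R.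
have c0 : 0 < c by rewrite mulr_gt0 // mulrn_wgt0 // pi_gt0.
pose om (i : nat) : R := c * i.+1%:R.
have om0 i : 0 < om i by rewrite mulr_gt0.
have om_inv : (fun i => (om i)^-1) @ \oo --> (0 : R).
  have -> : (fun i => (om i)^-1) = (fun i => c^-1 * harmonic i).
    by apply/funext => i; rewrite /om invfM.
  by rewrite -[X in _ --> X](mulr0 c^-1); exact: (cvgM (cvg_cst _) cvg_harmonic).
pose s i : C := ('i * (om i)%:C)^-1.
have s_neq0 i : s i != 0.
  by rewrite invr_eq0 mulf_neq0 ?complexiE ?neq0Ci // gt_eqF // ltcR.
have s_cvg : s @ \oo --> (0 : C).
  have -> : s = (fun i => 'i^-1 * ((om i)^-1)%:C).
    by apply/funext => i; rewrite /s invfM fmorphV.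
  by rewrite -[X in _ --> X](mulr0 'i^-1);
    exact: (cvgM (cvg_cst _) (cvg_real_complex om_inv)).
pose th' i k : R := th k - al k / om i.
have th'_cvg k : (fun i => th' i k) @ \oo --> th k.
  rewrite -[X in _ --> X]subr0 -(mulr0 (al k)).
  exact: (cvgB (cvg_cst _) (cvgM (cvg_cst _) om_inv)).
pose h i x := scaled_det E A0 A (s i) x (fun k => v k * cexp (- (x * (th' i k)%:C))).
have gE z : g z = scaled_det E A0 A 0 z (fun k => v k * cexp (- (z * (th k)%:C))).
  rewrite /g /q /G (scaled_det0_shift _ _ _ _ z); congr scaled_det.
  apply/funext => k; rewrite -cexpM_natl; congr (_ * cexp _).
  by rewrite /th rmorphM fmorphV !rmorph_nat; field.
have h_cvg T (F : set_system T) (FF : Filter F) (x : T -> C) (i : T -> nat) z :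
    x @ F --> z -> i @ F --> \oo -> (fun p => h (i p) (x p)) @ F --> g z.
  move=> xz ioo; rewrite gE; apply: cvg_scaled_det; [|exact: xz|].
    exact: (cvg_comp _ _ ioo s_cvg).
  move=> k.
  have thk : (fun p => (th' (i p) k)%:C) @ F --> (th k)%:C.
    by apply: cvg_real_complex; exact: (cvg_comp _ _ ioo (th'_cvg k)).
  have xthk : (fun p => - (x p * (th' (i p) k)%:C)) @ F --> - (z * (th k)%:C).
    exact: (cvgN (cvgM xz thk)).
  exact: (cvgM (cvg_cst _) (cvg_cexp xthk)).
have [x xr] : min_principle g sg%:C r; last first.
  by rewrite gsg mulr0 normr0 normr_le0; apply/negP; exact: gcirc.
apply: (@min_principle_lim R nat \oo _ h).
- by move=> z _; apply: h_cvg; [exact: cvg_fst|exact: cvg_snd].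
- by apply: h_cvg; [exact: cvg_cst|exact: cvg_id].
have near_th : \forall i \near \oo, forall k, `|th' i k - tau k| < delta.
  apply: filter_forall => k.
  have dk : 0 < delta - `|th k - tau k| by rewrite subr_gt0 nn_near.
  have /cvgrPdist_lt/(_ _ dk) := th'_cvg k; apply: filterS => i thi.
  rewrite -[th' i k](subrK (th k)) -addrA (le_lt_trans (ler_normD _ _)) //.
  by rewrite -ltrBrDr distrC.
apply: filterS near_th => i thi.
have h_neq0 (x : C) : `|x - sg%:C| <= r%:C -> h i x != 0.
  move=> xr; rewrite /h scaled_det_eq0 // /s invrK.
  rewrite (_ : (fun k => _) =
      fun k => cexp (- ((th' i k)%:C * (x + 'i * (om i)%:C)))).
    apply: stab => //; rewrite raddfD /= mul0r mul1r subr0 addr0.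
    have /andP[] := Re_le_norm xr; rewrite raddfB /= => h1 _.
    by lra.
  apply/funext => k; rewrite vE -cexpD.
  have -> : - ((th' i k)%:C * (x + 'i * (om i)%:C)) =
      'i * (al k)%:C - x * (th' i k)%:C - 'i * ((i.+1 * nn k)%:R * (pi *+ 2))%:C.
    have -> : ((i.+1 * nn k)%:R * (pi *+ 2))%:C = (om i)%:C * (th' i k)%:C + (al k)%:C :> C.
      rewrite -rmorphM -rmorphD; congr (_%:C).
      rewrite /th' mulrBr [om i * (al k / _)]mulrC divfK ?lt0r_neq0 // subrK.
      rewrite /om /c /th natrM; move: (pi *+ 2) => p2.
      by field; exact: lt0r_neq0.
    by move: (th' i k)%:C (om i)%:C (al k)%:C => a b d; ring.
  rewrite [RHS]cexpD.
  suff -> : cexp (- ('i * ((i.+1 * nn k)%:R * (pi *+ 2))%:C)) = 1 :> C by rewrite mulr1.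
  by rewrite -[LHS]mulr1 -[X in _ * X](cexp_2pi (i.+1 * nn k)) -cexpD addNr cexp0.
(* The minimum principle for h i itself: it is a limit of the polynomial
functions hK K. *)
pose hK K x := scaled_det E A0 A (s i) x
  (fun k => v k * (1 + - (x * (th' i k)%:C) / K%:R) ^+ K).
have hK_cvg T (F : set_system T) (FF : Filter F) (x : T -> C) (K : T -> nat) z :
    x @ F --> z -> K @ F --> \oo -> (fun p => hK (K p) (x p)) @ F --> h i z.
  move=> xz Koo; apply: cvg_scaled_det; [exact: cvg_cst|exact: xz|].
  move=> k.
  have xthk : (fun p => - (x p * (th' i k)%:C)) @ F --> - (z * (th' i k)%:C).
    exact: (cvgN (cvgM xz (cvg_cst _))).
  exact: (cvgM (cvg_cst _) (cvg_expn_cexp xthk Koo)).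
apply: (@min_principle_lim R nat \oo _ hK).
- by move=> z _; apply: hK_cvg; [exact: cvg_fst|exact: cvg_snd].
- by apply: hK_cvg; [exact: cvg_cst|exact: cvg_id].
have : \forall K \near \oo, forall x, `|x - sg%:C| <= r%:C -> hK K x != 0.
  apply: (@near_compact _ _ nat \oo _ (fun K x => hK K x != 0)
    (@compact_disc R sg%:C r)) => x xr.
  have hx : (fun p => hK p.2 p.1) @ filter_prod (nbhs x) \oo --> h i x.
    by apply: hK_cvg; [exact: cvg_fst|exact: cvg_snd].
  exact: (cvg_neq0 (h_neq0 x xr) hx).
apply: filterS => K hK_neq0; apply: min_principle_polyfun; [|exact: r0|exact: hK_neq0].
apply: polyfun_scaled_det => [|k]; first exact: polyfun_id.
apply: polyfunM; first exact: polyfun_cst.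
apply: polyfunX; apply: polyfunD; first exact: polyfun_cst.
apply: (@eq_polyfun R _ (fun z => z * (- (th' i k)%:C / K%:R))) => [z|]; first by ring.
by apply: polyfunM; [exact: polyfun_id|exact: polyfun_cst].
Qed.
End RationalDelays.
(** By induction on j, the case where only the coordinates below j may lie
inside the disc, the others being on the circle, and where coordinate k is
scaled by t ^ n_k.  For j = 0 this is the torus.  For the step, the scaled G is
a polynomial in coordinate j alone, it has no zero on the circle by induction,
and at t = 0 it is the nonzero constant G (0). *)
Lemma polydisc_neq0 (w : 'I_m.+1 -> C) : (forall k, `|w k| <= 1) ->
  G w != 0.
Proof.
move=> w1.
have [M [nn [M0 nnP]]] := rational_delays.
have nn_gt0 k : (0 < nn k)%N by have [] := nnP k.
have nn_near k : `|(nn k)%:R / M%:R - tau k| < delta by have [] := nnP k.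
have at0 (v : 'I_m.+1 -> C) : (fun k => v k * (0%:C : C) ^+ nn k) = fun=> 0.
  by apply/funext => k; rewrite expr0n eqn0Ngt nn_gt0 mulr0.
suff H j (v : 'I_m.+1 -> C) t : (forall k, `|v k| <= 1) ->
    (forall k : 'I_m.+1, (j <= k)%N -> `|v k| = 1) -> 0 <= t <= 1 ->
    G (fun k => v k * t%:C ^+ nn k) != 0.
  have := H m.+1 w 1 w1; rewrite (_ : (fun k => _) = w).
    by apply; [move=> k; rewrite leqNgt ltn_ord|rewrite ler01 lexx].
  by apply/funext => k; rewrite expr1n mulr1.
elim: j v t => [|j IH] v t v1 vj /andP[t0 t1].
  have [t_gt0|] := ltP 0 t.
    apply: (torus_neq0 M0 nn_gt0 nn_near); first by rewrite t_gt0.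
    by move=> k; exact: vj.
  by move=> t0'; have -> : t = 0; [apply/eqP; rewrite eq_le t0'|rewrite at0].
have [jm|mj] := ltnP j m.+1; last first.
  apply: (IH v t v1); last by rewrite t0.
  by move=> k jk; have := leq_ltn_trans jk (ltn_ord k); rewrite ltnNge mj.
pose u (y : C) (k : 'I_m.+1) := if k == j :> nat then y else v k.
pose f (t : R) (y : C) := G (fun k => u y k * t%:C ^+ nn k).
have fj : f t (v (Ordinal jm)) = G (fun k => v k * t%:C ^+ nn k).
  rewrite /f; congr G; apply/funext => k; rewrite /u.
  by case: eqP => // kj; congr (v _ * _); apply/val_inj; rewrite /= kj.
rewrite -fj; apply: (@disc_zero_free R f); last 2 first.
- by rewrite t0.
- exact: v1.
- move=> s; apply: polyfun_scaled_det => [|k]; first exact: polyfun_cst.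
  apply: polyfunM; last exact: polyfun_cst.
  by rewrite /u; case: (nat_of_ord k == j);
    [exact: (@polyfun_id R)|exact: (@polyfun_cst R)].
- move=> s y; apply: cvg_scaled_det; [exact: cvg_cst|exact: cvg_cst|].
  move=> k.
  have c1 : (fun p : R * C => u p.2 k) @ filter_prod (nbhs s) (nbhs y) --> u y k.
    by rewrite /u; case: (nat_of_ord k == j); [exact: cvg_snd|exact: cvg_cst].
  have c2 : (fun p : R * C => p.1%:C ^+ nn k) @ filter_prod (nbhs s) (nbhs y)
      --> s%:C ^+ nn k.
    by apply: cvg_expc; apply: cvg_real_complex; exact: cvg_fst.
  exact: (cvgM c1 c2).
- move=> s y s01 y1.
  have u1 k : `|u y k| <= 1 by rewrite /u; case: eqP => _; rewrite ?y1.
  have uj (k : 'I_m.+1) : (j <= k)%N -> `|u y k| = 1.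
    rewrite /u; case: eqP => [_ _|/eqP kj jk]; first exact: y1.
    by apply: vj; rewrite ltn_neqAle eq_sym kj.
  exact: (IH (u y) s u1 uj s01).
- by move=> y _; rewrite /f at0; exact: G0.
Qed.

(** The scaled determinant has no zero at s = 0 on the compact polydisc, hence
none there for small s = 1 / lambda. *)
Lemma large_frequency_neq0 : exists2 Om : R, 0 < Om &
  forall (s : C) (w : 'I_m.+1 -> C), Om%:C <= `|s| -> (forall k, `|w k| <= 1) ->
  \det (char_pencil E A0 A s w) != 0.
Proof.
pose K := [set w : 'rV[C]_m.+1 | forall k, [set z : C | `|z| <= 1] (w ord0 k)].
have disc1 := @compact_unit_disc R.
have cK : compact K by exact: (@rV_compact C m.+1 (fun=> [set z : C | `|z| <= 1])).
have : \forall s \near (0 : C), forall w, K w -> scaled_det E A0 A s 0 (w ord0) != 0.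
  apply: (@near_compact _ K C (nbhs (0 : C)) _
    (fun s w => scaled_det E A0 A s 0 (w ord0) != 0) cK) => w Kw.
  have cw : (fun p : 'rV[C]_m.+1 * C => scaled_det E A0 A p.2 0 (p.1 ord0))
      @ filter_prod (nbhs w) (nbhs (0 : C)) --> scaled_det E A0 A 0 0 (w ord0).
    apply: cvg_scaled_det; [exact: cvg_snd|exact: cvg_cst|] => k.
    have ck : (fun v : 'rV[C]_m.+1 => v ord0 k) @ nbhs w --> w ord0 k.
      move=> B wB; exists (fun i j => [set z | (i == ord0) && (j == k) -> B z]).
        move=> i j /=; have [/andP[/eqP-> /eqP->]|_] := boolP ((i == ord0) && (j == k)).
          by apply: filterS wB => z Bz _.
        by apply: filterS filterT => z _.
      by move=> v vB; apply: (vB ord0 k); rewrite !eqxx.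
    exact: (cvg_comp _ _ cvg_fst ck).
  exact: (cvg_neq0 (polydisc_neq0 Kw) cw).
move/near_norm_ball => [e e0 eP]; exists (2 / e); first by rewrite divr_gt0.
move=> s w sOm w1.
have s0 : s != 0.
  by rewrite -normr_gt0 (lt_le_trans _ sOm) // ltcR divr_gt0.
have := @scaled_det_eq0 R n m E A0 A s^-1 0 w; rewrite invrK add0r invr_eq0 => /(_ s0) <-.
have := eP s^-1; rewrite subr0 normfV => /(_ _ (\row_k w k)).
rewrite (_ : (\row_k w k) ord0 = w); last by apply/funext => k; rewrite mxE.
apply; last by move=> k /=; rewrite mxE.
rewrite -(@ltr_pM2r _ `|s|) ?normr_gt0 // mulVf ?normr_eq0 //.
apply: lt_le_trans (ler_wpM2l _ sOm); last by rewrite ler0c ltW.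
by rewrite -rmorphM mulrCA mulfV ?mulr1 ?gt_eqF // (ltcR 1 2) ltr1n.
Qed.

End Polydisc.

(** * Tau equation on one segment *)

Section Rodrigues.
Context {K : numFieldType}.
Implicit Types (a b c d e : K) (p : {poly K}).

Lemma coef_expXaddC e N j : (j <= N)%N ->
  ((e%:P + 'X) ^+ N)`_j = e ^+ (N - j) *+ 'C(N, j).
Proof.
move=> jN; rewrite exprDn coef_sum (bigD1 (Ordinal (jN : (j < N.+1)%N))) //=.
rewrite big1 ?addr0 => [|i ij].
  by rewrite coefMn -polyC_exp coefCM coefXn eqxx mulr1.
rewrite coefMn -polyC_exp coefCM coefXn.
have /negbTE-> : j != i :> nat by apply: contra ij => /eqP ji; apply/eqP/val_inj.
by rewrite mulr0 mul0rn.
Qed.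

Lemma derivnD p j k : p^`(j + k) = (p^`(k))^`(j).
Proof. by elim: j => // j IH; rewrite addSn !derivnS IH. Qed.

Lemma derivn_comp_affine p (c d : K) k :
  (p \Po (c *: 'X + d%:P))^`(k) = c ^+ k *: (p^`(k) \Po (c *: 'X + d%:P)).
Proof.
elim: k => [|k IH]; first by rewrite expr0 scale1r.
rewrite derivnS IH derivZ deriv_comp -derivnS derivD derivZ derivX derivC addr0.
by rewrite alg_polyC mulrC mul_polyC scalerA exprSr.
Qed.

(** The values at the end points of the derivatives of
((X - c) (X - d)) ^ N; they produce the coefficients of the Padé denominators. *)
Lemma derivn_bump_end c d N j : (j <= N)%N ->
  ((('X - c%:P) ^+ N * ('X - d%:P) ^+ N)^`(N + j)).[c] =
  ((N + j)`! * 'C(N, j))%:R * (c - d) ^+ (N - j).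
Proof.
move=> jN; set W := _ * _.
pose T : {poly K} := 'X^N * ((c - d)%:P + 'X) ^+ N.
have WE : W = T \Po (1 *: 'X + (- c)%:P).
  rewrite /W /T comp_polyM !rmorphXn /= comp_polyX rmorphD /= comp_polyX comp_polyC.
  rewrite scale1r polyCN; congr (_ * _ ^+ _); rewrite polyCB; ring.
rewrite WE derivn_comp_affine expr1n scale1r horner_comp.
rewrite !hornerE subrr horner_coef0 coef_derivn addn0 ffactnn coefXnM.
rewrite ltnNge leq_addr /= addKn coef_expXaddC //.
by rewrite -mulrnA -[LHS]mulr_natl mulnC.
Qed.

End Rodrigues.

Section SegmentTau.
Context {R : realType}.
Local Notation C := R[i].
Variables (a b : R) (N : nat).
Hypothesis ab : a < b.

Let W : {poly C} := ('X - a%:C%:P) ^+ N * ('X - b%:C%:P) ^+ N.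
Let psi := W^`(N).

Lemma seg_legendreE : exists k : C, seg_legendre a b N = k *: psi.
Proof.
pose l : {poly R} := (2 / (b - a)) *: 'X + (- ((a + b) / (b - a)))%:P.
pose V : {poly R} := ('X - a%:P) ^+ N * ('X - b%:P) ^+ N.
have ba : b - a != 0 by rewrite subr_eq0 gt_eqF.
have lE : ('X ^+ 2 - 1) ^+ N \Po l = ((2 / (b - a)) ^+ 2) ^+ N *: V.
  rewrite /V rmorphXn /= -exprMn -exprZn; congr (_ ^+ _).
  rewrite rmorphB rmorphXn /= comp_polyX rmorph1 /l.
  set c := 2 / (b - a); set e := - ((a + b) / (b - a)).
  apply/eqP; rewrite -subr_eq0.
  have -> : (c *: 'X + e%:P) ^+ 2 - 1 - c ^+ 2 *: (('X - a%:P) * ('X - b%:P)) =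
      (2 * c * e + c ^+ 2 * (a + b))%:P * 'X + (e ^+ 2 - 1 - c ^+ 2 * (a * b))%:P :> {poly R}.
    rewrite -!mul_polyC !(polyCD, polyCN, polyCB, polyCM, polyC_exp, polyC1, polyC_natr) /=.
    by ring.
  have -> : 2 * c * e + c ^+ 2 * (a + b) = 0 by rewrite /c /e; field.
  have -> : e ^+ 2 - 1 - c ^+ 2 * (a * b) = 0 by rewrite /c /e; field.
  by rewrite mul0r addr0.
have -> : seg_legendre a b N = map_poly (real_complex R) (legendre R N \Po l).
  by rewrite /seg_legendre /l polyCN.
pose k : R := (2 ^ N * N`!)%:R^-1 * ((2 / (b - a)) ^+ N)^-1 * ((2 / (b - a)) ^+ 2) ^+ N.
exists (k%:C).
have c0 : (2 / (b - a)) ^+ N != 0 by rewrite expf_neq0 // mulf_neq0 ?invr_eq0 // pnatr_eq0.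
rewrite /legendre comp_polyZ.
have -> : (('X ^+ 2 - 1) ^+ N)^`(N) \Po l =
    ((2 / (b - a)) ^+ N)^-1 *: (((2 / (b - a)) ^+ 2) ^+ N *: V)^`(N).
  by rewrite -lE derivn_comp_affine scalerA mulVf // scale1r.
rewrite derivnZ !scalerA map_polyZ; congr (_ *: _).
rewrite -derivn_map /psi /W /V rmorphM !rmorphXn /= !rmorphB /= map_polyX !map_polyC //.
Qed.

Lemma size_bump : (size W <= N + N.+1)%N.
Proof.
by rewrite (leq_trans (size_polyMleq _ _)) // !size_exp_XsubC addSn.
Qed.

Lemma scaled_deriv_inj (c : C) (p : {poly C}) : c != 0 -> c *: p = p^`() -> p = 0.
Proof.
move=> c0 cp; apply/eqP; apply: contraT => p0.
by have := lt_size_deriv p0; rewrite -cp size_scale // ltnn.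
Qed.

(** The finite Neumann series of z ^ N.+1 (z - D) ^-1 applied to psi, D being the
derivation, which is nilpotent on polynomials. *)
Definition tau_sol (z : C) : {poly C} := \sum_(j < N.+1) z ^+ (N - j) *: psi^`(j).

Lemma tau_solE (z : C) : z *: tau_sol z - (tau_sol z)^`() = z ^+ N.+1 *: psi.
Proof.
rewrite /tau_sol scaler_sumr raddf_sum /= big_ord_recl big_ord_recr /=.
rewrite derivZ -derivnS.
have -> : psi^`(N.+1) = 0.
  by rewrite /psi -derivnD; apply: derivn_poly0; rewrite addnC size_bump.
rewrite scaler0 addr0 subn0 scalerA -exprS -addrA -[RHS]addr0; congr (_ + _).
apply/eqP; rewrite subr_eq0; apply/eqP.
apply: eq_bigr => j _; rewrite derivZ -derivnS scalerA -exprS /=.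
by rewrite /bump leq0n add1n subnSK.
Qed.

Lemma tau_sol_end (z c d : C) : W = ('X - c%:P) ^+ N * ('X - d%:P) ^+ N ->
  (tau_sol z).[c] = N`!%:R * (pade_den N).[z * (c - d)].
Proof.
move=> WE; rewrite /tau_sol horner_sum horner_poly mulr_sumr.
rewrite (reindex_inj rev_ord_inj) /=; apply: eq_bigr => i _.
have iN : (i <= N)%N by rewrite -ltnS.
rewrite subSS subKn // hornerZ /psi -derivnD addnC WE derivn_bump_end ?leq_subr //.
rewrite subKn // exprMn [LHS]mulrCA [RHS]mulrA; congr (_ * _).
rewrite /pade_coef addnBA // natrM bin_sub //.
have := bin_fact iN => /(congr1 (fun k => k%:R : C)); rewrite !natrM => <-.
by field; rewrite !natr_fact_neq0.
Qed.

(** The truncation removes a multiple of the Legendre polynomial, so the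
equation reads lam xi - xi' = const * psi.  As lam - D is injective for
lam <> 0, xi is a multiple of tau_sol lam, whose end values are Padé
denominators by tau_sol_end.  The denominator does not vanish in the right half
plane, so the right end value determines xi. *)
Lemma tau_segment (lam : C) (xi : {poly C}) : 0 <= complex.Re lam ->
  lam *: legendre_trunc a b N xi = xi^`() ->
  xi.[a%:C] = pade N (lam * (b - a)%:C) * xi.[b%:C] /\
  (xi.[b%:C] = 0 -> xi = 0).
Proof.
move=> Relam; have [k phiE] := seg_legendreE.
rewrite /legendre_trunc /= phiE; set c := _ / _; rewrite scalerA.
have [->|l0] := eqVneq lam 0.
  rewrite scale0r mul0r /pade oppr0 divff ?pade_den_neq0 // mul1r => /esym xi0.
  have sxi : (size xi <= 1)%N.
    apply/leq_sizeP => -[//|j _]; have := congr1 (fun p : {poly C} => p`_j) xi0.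
    by rewrite coef_deriv coef0 => /eqP; rewrite mulrn_eq0 /= => /eqP.
  by have /size1_polyC-> := sxi; rewrite !hornerC; split=> // ->.
move=> eq1.
have {}eq1 : lam *: xi - xi^`() = (lam * (c * k)) *: psi.
  by rewrite -eq1 scalerBr scalerA opprB addrC subrK.
pose d := c * k / lam ^+ N.
have xiE : xi = d *: tau_sol lam.
  apply/eqP; rewrite -subr_eq0; apply/eqP; apply: (scaled_deriv_inj l0).
  apply/eqP; rewrite -subr_eq0.
  have -> : lam *: (xi - d *: tau_sol lam) - (xi - d *: tau_sol lam)^`() =
      (lam *: xi - xi^`()) - d *: (lam *: tau_sol lam - (tau_sol lam)^`()).
    by rewrite derivB derivZ -!mul_polyC; ring.
  rewrite eq1 tau_solE scalerA (_ : d * _ = lam * (c * k)) ?subrr //.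
  by rewrite /d exprS mulrCA [_ * (lam ^+ N)]mulrC mulrC divfK ?expf_neq0 // mulrC.
clearbody d; have ba : 0 < b - a by rewrite subr_gt0.
have endb : xi.[b%:C] = d * (N`!%:R * (pade_den N).[lam * (b - a)%:C]).
  by rewrite xiE hornerZ (@tau_sol_end _ b%:C a%:C) ?rmorphB // /W mulrC.
have enda : xi.[a%:C] = d * (N`!%:R * (pade_den N).[- (lam * (b - a)%:C)]).
  rewrite (_ : - (lam * (b - a)%:C) = lam * (a%:C - b%:C)); last by rewrite rmorphB; ring.
  by rewrite xiE hornerZ (@tau_sol_end _ a%:C b%:C).
have Q0 : (pade_den N).[lam * (b - a)%:C] != 0.
  apply: pade_den_neq0; case: (lam) Relam => x y /= x0.
  by rewrite mulr0 subr0 mulr_ge0 // ltW.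
split; first by rewrite endb enda /pade; field.
rewrite endb => /eqP; rewrite !mulf_eq0 (negbTE Q0) orbF pnatr_eq0 eqn0Ngt fact_gt0 orbF.
by rewrite xiE => /eqP->; rewrite scale0r.
Qed.
End SegmentTau.

(** * Discretized pencil *)

Section LinearBijection.
Context {K : fieldType}.

Let dim_ffun (vT : vectType K) (I : finType) : dim {ffun I -> vT} = (#|I| * dim vT)%N.
Proof. by []. Qed.
Let dim_prod (vT wT : vectType K) : dim (vT * wT)%type = (dim vT + dim wT)%N.
Proof. by []. Qed.
Let dim_mx p q : dim 'M[K]_(p, q) = (p * q)%N.
Proof. by []. Qed.
Let dim_npoly p : dim {poly_p K} = p.
Proof. by []. Qed.

Lemma dim_spline_eq n m N :
  dim {ffun 'I_m.+1 -> {ffun 'I_n -> {poly_N.+1 K}}} =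
  dim ('cV[K]_n * {ffun 'I_m.+1 -> {ffun 'I_n -> {poly_N K}}} *
       {ffun 'I_m -> 'cV[K]_n})%type.
Proof. by rewrite !dim_ffun !dim_prod !dim_ffun !dim_mx !dim_npoly !card_ord; nia. Qed.

Lemma linear_inj_bij (vT wT : vectType K) (f : vT -> wT) : linear f ->
  dim vT = dim wT -> (forall v, f v = 0 -> v = 0) -> bijective f.
Proof.
move=> f_lin dimE f_inj.
pose fM := GRing.isLinear.Build K vT wT *:%R f f_lin.
pose fL : {linear vT -> wT} := HB.pack f fM.
have fE v : linfun fL v = f v by rewrite lfunE.
have ker0 : lker (linfun fL) == 0%VS.
  apply/lker0P => u v; rewrite !fE => uv; apply/eqP; rewrite -subr_eq0; apply/eqP.
  by apply: f_inj; rewrite -[f _]/(fL _) raddfB /= uv subrr.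
have img : limg (linfun fL) = fullv.
  have cap0 : (fullv :&: lker (linfun fL))%VS = 0%VS by rewrite (eqP ker0) capv0.
  by apply/eqP; rewrite eqEdim subvf /= (limg_dim_eq cap0) !dimvf dimE.
exists (linfun fL)^-1%VF => [v|w].
  by rewrite -fE lker0_lfunK.
by rewrite -fE limg_lfunVK // img memvf.
Qed.
End LinearBijection.

(** The truncation has degree below N, so the coefficient of the Legendre
polynomial that it removes is the quotient of the leading coefficients; no
integral is left, and linearity becomes visible. *)
Lemma legendre_truncE (R : realType) (a b : R) N (P : {poly R[i]}) : a < b ->
  (size P <= N.+1)%N -> legendre_trunc a b N P =
  P - (P`_N / (seg_legendre a b N)`_N) *: seg_legendre a b N.
Proof.
move=> ab sP; set phi := seg_legendre a b N.
have coefN (Q : {poly R[i]}) : (size Q <= N.+1)%N ->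
    exists2 c, legendre_trunc a b N Q = Q - c *: phi & Q`_N = c * phi`_N.
  move=> sQ; have := legendre_trunc_size ab sQ.
  rewrite /legendre_trunc /= -/phi; set c := _ / _ => /leq_sizeP/(_ N (leqnn N)) cN.
  by exists c => //; apply/eqP; rewrite -subr_eq0 -coefZ -coefB cN.
have phiN : phi`_N != 0.
  have [|c _] := coefN 'X^N; first by rewrite size_polyXn.
  by rewrite coefXn eqxx; apply: contra_eqN => /eqP->; rewrite mulr0 oner_eq0.
by have [c -> ->] := coefN P sP; rewrite mulfK.
Qed.

Section SplineKernel.
Context {R : realType} {n p q m : nat} (S : ddae R n p q m) (N : nat).
Local Notation C := R[i].

Lemma spline_eval_linear k th (a : C) (X Y : spline R n m N) :
  spline_eval k th (a *: X + Y) = a *: spline_eval k th X + spline_eval k th Y.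
Proof.
apply/colP => j; rewrite !mxE !ffunE -hornerZ -hornerD; congr (_.[_]).
Qed.

Lemma spline_E_linear : linear (@spline_E R n p q m S N).
Proof.
move=> a X Y; rewrite /spline_E spline_eval_linear.
congr (_, _, _).
- by rewrite /= mulmxDr scalemxAr.
- rewrite /=; apply/ffunP => k; rewrite !ffunE; apply/ffunP => j; rewrite !ffunE.
  apply: val_inj.
  have sXY := size_npoly (a *: X k j + Y k j : {poly_N.+1 C}).
  rewrite /= !legendre_truncE ?size_npoly ?seg_lt //.
  rewrite coefD coefZ -!mul_polyC !(polyCD, polyCM, mulrDl).
  by ring.
- by rewrite /=; apply/ffunP => k; rewrite !ffunE scaler0 addr0.
Qed.

Lemma spline_A_linear : linear (@spline_A R n p q m S N).
Proof.
move=> a X Y; rewrite /spline_A !spline_eval_linear.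
congr (_, _, _).
- rewrite /= mulmxDr -scalemxAr scalerDr addrACA; congr (_ + _).
  rewrite scaler_sumr -big_split; apply: eq_bigr => k _ /=.
  by rewrite spline_eval_linear mulmxDr scalemxAr.
- rewrite /=; apply/ffunP => k; rewrite !ffunE; apply/ffunP => j; rewrite !ffunE.
  apply: val_inj.
  by rewrite /= derivD derivZ.
- rewrite /=; apply/ffunP => k; rewrite !ffunE /= !spline_eval_linear.
  by rewrite scalerBr opprD addrACA.
Qed.

(** The length of segment j, defined on all natural numbers so that it
telescopes. *)
Definition gap (j : nat) : R := ddae_tau S (inord j.+1) - ddae_tau S (inord j).

Definition pade_factor (lam : C) (k : 'I_m.+1) : C :=
  \prod_(j < k.+1) pade N (lam * (gap j)%:C).

Lemma gapE (k : 'I_m.+1) : gap k = seg_r S k - seg_l S k.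
Proof.
rewrite /gap /seg_r /seg_l opprK addrC; congr (- ddae_tau S _ + ddae_tau S _).
  by apply/val_inj; rewrite /= inordK // ltnS ltnW.
by apply/val_inj; rewrite /= inordK // ltnS.
Qed.

(** The tau equation on each segment and the matching conditions make every
interface value a multiple of the value x at 0; the first component then says
that the modified characteristic matrix kills x, so x and with it all interface
values vanish. *)
Lemma spline_kernel0 (lam : C) (X : spline R n m N) : 0 <= complex.Re lam ->
  \det (char_pencil (ddae_E S) (ddae_A S ord0)
          (fun k => ddae_A S (lift ord0 k)) lam (pade_factor lam)) != 0 ->
  (lam *: spline_E S X - spline_A S X : spline_codom R n m N) = 0 -> X = 0.
Proof.
move=> Relam det0 eqX.
have e1 := congr1 (fun z : spline_codom R n m N => z.1.1) eqX.
have e2 := congr1 (fun z : spline_codom R n m N => z.1.2) eqX.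
have e3 := congr1 (fun z : spline_codom R n m N => z.2) eqX.
rewrite /= in e1 e2 e3.
pose xr k := spline_eval k (seg_r S k) X.
pose xl k := spline_eval k (seg_l S k) X.
have seg k j := @tau_segment R (seg_l S k) (seg_r S k) N (seg_lt S k) lam
  (polyn (X k j)) Relam.
have {}seg k j : ((polyn (X k j)).[(seg_l S k)%:C] =
       pade N (lam * (gap k)%:C) * (polyn (X k j)).[(seg_r S k)%:C]) /\
    ((polyn (X k j)).[(seg_r S k)%:C] = 0 -> polyn (X k j) = 0).
  rewrite gapE; apply: seg.
  have := congr1
    (fun z : {ffun 'I_m.+1 -> {ffun 'I_n -> {poly_N C}}} => polyn (z k j)) e2.
  rewrite !ffunE /= => /eqP; rewrite subr_eq0 => /eqP.
  by [].
have xlE k : xl k = pade N (lam * (gap k)%:C) *: xr k.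
  by apply/colP => j; rewrite !mxE; have [] := seg k j.
have xr0 : xr ord0 = spline_eval ord0 0 X.
  rewrite /xr /seg_r (_ : widen_ord _ _ = ord0) ?ddae_tau0 ?oppr0 //.
  exact: val_inj.
have step (k : 'I_m) : xr (lift ord0 k) = xl (widen_ord (leqnSn m) k).
  have := congr1 (fun z : {ffun 'I_m -> 'cV[C]_n} => z k) e3.
  rewrite !ffunE /= scaler0 sub0r => /eqP; rewrite oppr_eq0 subr_eq0 => /eqP h.
  rewrite /xl h; congr spline_eval; rewrite /seg_r /seg_l; congr (- ddae_tau S _).
  exact: val_inj.
have xlx k : xl k = pade_factor lam k *: xr ord0.
  case: k => k km; elim: k km => [|k IH] km.
    rewrite xlE /pade_factor big_ord1 /= (_ : Ordinal km = ord0) //; exact: val_inj.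
  have km' : (k < m.+1)%N by apply: ltnW.
  have km'' : (k < m)%N by [].
  have kE : Ordinal km = lift ord0 (Ordinal km'') by exact: val_inj.
  have kE' : Ordinal km' = widen_ord (leqnSn m) (Ordinal km'') by exact: val_inj.
  rewrite xlE {2}kE step -kE' IH /pade_factor /= [in RHS]big_ord_recr /=.
  by rewrite scalerA mulrC.
have x0 : xr ord0 = 0.
  have u : char_pencil (ddae_E S) (ddae_A S ord0)
      (fun k => ddae_A S (lift ord0 k)) lam (pade_factor lam) \in unitmx.
    by rewrite unitmxE unitfE.
  rewrite -[LHS](mulKmx u) (_ : _ *m xr ord0 = 0) ?mulmx0 //.
  rewrite /char_pencil !mulmxBl -scalemxAl -[RHS]e1 xr0 opprD addrA; congr (_ - _).
  rewrite mulmx_suml; apply: eq_bigr => k _.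
  by rewrite -/(xl k) xlx xr0 -scalemxAl scalemxAr.
have xr_eq0 k : xr k = 0.
  case: k => -[|k] km.
    by rewrite -[RHS]x0; congr xr; exact: val_inj.
  rewrite (_ : Ordinal km = lift ord0 (Ordinal (km : (k < m)%N))); last exact: val_inj.
  by rewrite step xlx x0 scaler0.
apply/ffunP => k; apply/ffunP => j; rewrite !ffunE; apply: val_inj.
have [_] := seg k j; apply.
by have := congr1 (fun v : 'cV[C]_n => v j ord0) (xr_eq0 k); rewrite !mxE.
Qed.

Lemma spline_bijective (lam : C) : 0 <= complex.Re lam ->
  \det (char_pencil (ddae_E S) (ddae_A S ord0)
          (fun k => ddae_A S (lift ord0 k)) lam (pade_factor lam)) != 0 ->
  bijective (fun X : spline R n m N =>
    (lam *: spline_E S X - spline_A S X : spline_codom R n m N)).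
Proof.
move=> Relam det0; apply: linear_inj_bij.
- move=> a X Y; rewrite spline_E_linear spline_A_linear.
  rewrite [LHS](_ : _ = a *: (lam *: spline_E S X - spline_A S X)
    + (lam *: spline_E S Y - spline_A S Y)) //.
  rewrite scalerDr !scalerBr !scalerA [a * lam]mulrC opprD addrACA; by [].
- exact: dim_spline_eq.
- by move=> X; exact: spline_kernel0.
Qed.
End SplineKernel.

(** * Preservation of stability *)

Lemma semi_explicit_index (R : realType) (n p q m : nat) (S : ddae R n p q m) :
  semi_explicit S -> index_le1 (ddae_E S) (ddae_A S ord0).
Proof.
move=> hidx x Ex xker; set E := ddae_E S in Ex hidx xker *.
pose r := \rank (kermx E^T).
have rE : \rank (kermx E) = r by rewrite /r !mxrank_ker mxrank_tr.
have [U Ufree UE] : exists2 U : 'M[R[i]]_(r, n), row_free U & (U :=: kermx E)%MS.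
  case: r / rE; exists (row_base (kermx E)); [exact: row_base_free|exact: eq_row_base].
pose V := (row_base (kermx E^T))^T.
have VU : U *m ddae_A S ord0 *m V \in unitmx.
  apply: hidx.
    split; rewrite /V trmxK ?row_base_free //; apply/eqmxP; exact: eq_row_base.
  split.
    by rewrite map_trmx trmxK row_free_map.
  rewrite !map_trmx !trmxK -map_kermx; apply/eqmxP.
  by apply/eqmxP; rewrite !map_submx; apply/eqmxP.
have [z xz] : exists z, x = V *m z.
  have : (x^T <= row_base (kermx E^T))%MS.
    by rewrite eq_row_base; apply/sub_kermxP; rewrite -trmx_mul Ex trmx0.
  by case/submxP => D xD; exists D^T; rewrite -[LHS]trmxK xD trmx_mul.
have UAx : U *m ddae_A S ord0 *m x = 0.
  apply/row_matrixP => i; rewrite row0 !row_mul; apply: xker.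
  by apply/sub_kermxP; rewrite (submx_trans (row_sub i U)) // UE.
suff z0 : z = 0 by rewrite xz z0 mulmx0.
have Vz : U *m ddae_A S ord0 *m V *m z = 0 by rewrite -[LHS]mulmxA -xz.
by rewrite -[LHS](mulKmx VU) Vz mulmx0.
Qed.

(** A negative supremum leaves a margin eps in the half plane.  The margin
delta in the delays is measured coordinatewise; its bound by the smallest delay
keeps the perturbed delays nonnegative. *)
Lemma stability_margin (R : realType) (n p q m : nat) (S : ddae R n p q m) :
  strongly_exponentially_stable S ->
  exists eps delta : R, [/\ 0 < eps, 0 < delta &
    forall theta : 'I_m.+1 -> R,
    (forall k, `|theta k - ddae_tau S (lift ord0 k)| < delta) ->
    forall s : R[i], - eps <= complex.Re s ->
    \det (char_pencil (ddae_E S) (ddae_A S ord0) (fun k => ddae_A S (lift ord0 k))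
            s (fun k => cexp (- ((theta k)%:C * s)))) != 0].
Proof.
case=> d0 d0_gt0; set M := ereal_sup _ => M0.
have [eps eps0 Meps] : exists2 eps : R, 0 < eps & (M < (- eps)%:E)%E.
  case: M M0 => [r| |] //; last by move=> _; exists 1; rewrite ?ltNyr.
  rewrite lte_fin => r0; exists (- r / 2); first by rewrite divr_gt0 // oppr_gt0.
  by rewrite lte_fin; lra.
pose tau k := ddae_tau S (lift ord0 k).
have tau_gt0 k : 0 < tau k by rewrite -(ddae_tau0 S) ddae_tau_lt // lift0.
pose t1 := tau ord0.
have t1_le k : t1 <= tau k.
  have [->//|k0] := eqVneq k ord0; apply: ltW; apply: ddae_tau_lt.
  by rewrite !lift0 ltnS lt0n.
exists eps, (Num.min t1 (d0 / m.+1%:R)); split => //.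
  by rewrite lt_min tau_gt0 divr_gt0.
move=> theta th_near s Res; apply/eqP => dets.
pose th : 'rV[R]_m.+1 := \row_k theta k.
have : (spectral_abscissa S th <= M)%E.
  apply: ereal_sup_ubound; exists th => //; split=> [k|].
    rewrite mxE; have := th_near k; rewrite lt_min => /andP[].
    rewrite ltr_norml => /andP[h _] _; have := t1_le k; rewrite -/(tau k) in h; lra.
  have mm : 0 < m.+1%:R :> R by rewrite ltr0n.
  rewrite /euclidean_norm -[ltRHS]ger0_norm ?(ltW d0_gt0) // -sqrtr_sqr ltr_sqrt ?exprn_gt0 //.
  apply: (@lt_le_trans _ _ (\sum_(k < m.+1) (d0 / m.+1%:R) ^+ 2)).
    apply: ltr_sum => [|k _]; first by apply/hasP; exists ord0; rewrite ?mem_index_enum.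
    rewrite !mxE; have := th_near k; rewrite lt_min => /andP[_ h].
    by rewrite -real_normK ?num_real // ltrXn2r // divr_ge0 // ltW.
  rewrite sumr_const card_ord -[leLHS]mulr_natr.
  have -> : (d0 / m.+1%:R) ^+ 2 * m.+1%:R = d0 ^+ 2 / m.+1%:R by field; exact: lt0r_neq0.
  by rewrite ler_pdivrMr //; apply: ler_peMr; [exact: sqr_ge0|rewrite ler1n].
move=> /le_lt_trans/(_ Meps); apply/negP; rewrite -leNgt.
apply: (@le_trans _ _ (complex.Re s)%:E); first by rewrite lee_fin.
apply: ereal_sup_ubound; exists s => //=.
rewrite /char_mx -[RHS]dets /char_pencil; congr (\det (_ - _)).
by apply: eq_bigr => k _; rewrite mxE.
Qed.

Lemma cvg_char_pencil (R : realType) (n m : nat) (E A0 : 'M[R[i]]_n)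
    (A : 'I_m.+1 -> 'M[R[i]]_n) T (F : set_system T) {FF : Filter F}
    (s : T -> R[i]) (w : T -> 'I_m.+1 -> R[i]) (s0 : R[i]) (w0 : 'I_m.+1 -> R[i]) :
  s @ F --> s0 -> (forall k, (fun t => w t k) @ F --> w0 k) ->
  (fun t => \det (char_pencil E A0 A (s t) (w t))) @ F --> \det (char_pencil E A0 A s0 w0).
Proof.
move=> cs cw; apply: cvg_det => i j.
have entry s' w' : char_pencil E A0 A s' w' i j =
    s' * E i j - A0 i j - \sum_k w' k * A k i j.
  by rewrite !mxE summxE; congr (_ - _); apply: eq_bigr => k _; rewrite mxE.
rewrite entry; under eq_fun do rewrite entry.
have csum : (fun t => \sum_k w t k * A k i j) @ F --> \sum_k w0 k * A k i j.
  by apply: cvg_sumc => k _; exact: (cvgM (cw k) (cvg_cst _)).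
exact: (cvgB (cvgB (cvgM cs (cvg_cst _)) (cvg_cst _)) csum).
Qed.

Lemma cvg_pade_factor (R : realType) (n p q m : nat) (S : ddae R n p q m)
    T (F : set_system T) {FF : Filter F} (N : T -> nat) (lam : T -> R[i]) (l : R[i]) k :
  N @ F --> \oo -> lam @ F --> l ->
  (fun t => pade_factor S (N t) (lam t) k) @ F -->
    cexp (- ((ddae_tau S (lift ord0 k))%:C * l)).
Proof.
move=> Noo laml; rewrite /pade_factor.
have -> : ddae_tau S (lift ord0 k) = \sum_(j < k.+1) gap S j.
  rewrite -(big_mkord xpredT (gap S)) telescope_sumr //.
  rewrite (_ : inord 0 = ord0) ?ddae_tau0 ?subr0.
    by congr ddae_tau; apply: val_inj; rewrite /= inordK // ltnS.
  by apply: val_inj; rewrite /= inordK.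
have -> : cexp (- ((\sum_(j < k.+1) gap S j)%:C * l)) =
    \prod_(j < k.+1) cexp (- (l * (gap S j)%:C)).
  rewrite rmorph_sum mulr_suml -sumrN.
  rewrite (big_morph _ (@cexpD R) (@cexp0 R)).
  by apply: eq_bigr => j _; rewrite mulrC.
apply: cvg_prodc => j _; apply: cvg_pade; first exact: Noo.
exact: (cvgM laml (cvg_cst _)).
Qed.

Theorem theorem5p1 (R : realType) (n p q m : nat) (S : ddae R n p q m)
    (hidx : semi_explicit S) (hstab : strongly_exponentially_stable S) :
  exists2 N0 : nat, (1 <= N0)%N &
    forall N : nat, (N0 <= N)%N -> forall lambda : R[i],
      ~ bijective (fun Xi : spline R n m N =>
                     (lambda *: spline_E S Xi - spline_A S Xi
                      : spline_codom R n m N)) ->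
      complex.Re lambda < 0.
Proof.
have idx := semi_explicit_index hidx.
have [eps [delta [eps0 delta0 stab]]] := stability_margin hstab.
have tau_gt0 k : 0 < ddae_tau S (lift ord0 k).
  by rewrite -(ddae_tau0 S) ddae_tau_lt // lift0.
have [Om Om0 large] := large_frequency_neq0 idx eps0 delta0 tau_gt0 stab.
pose D N (lam : R[i]) := \det (char_pencil (ddae_E S) (ddae_A S ord0)
  (fun k => ddae_A S (lift ord0 k)) lam (pade_factor S N lam)).
pose K := [set z : R[i] | 0 <= complex.Re z <= Om /\ - Om <= complex.Im z <= Om].
(* Bounded frequencies: uniform convergence on a compact rectangle. *)
have : \forall N \near \oo, forall lam, K lam -> D N lam != 0.
  apply: (@near_compact _ K nat \oo _ (fun N lam => D N lam != 0) (@compact_rect R _ _ _ _)).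
  move=> l [/andP[Rel _] _].
  have Dl : (fun t => D t.2 t.1) @ filter_prod (nbhs l) \oo -->
      \det (char_pencil (ddae_E S) (ddae_A S ord0) (fun k => ddae_A S (lift ord0 k)) l
        (fun k => cexp (- ((ddae_tau S (lift ord0 k))%:C * l)))).
    apply: cvg_char_pencil; first exact: cvg_fst.
    by move=> k; apply: cvg_pade_factor; [exact: cvg_snd|exact: cvg_fst].
  apply: (cvg_neq0 _ Dl); apply: stab => [k|].
    by rewrite subrr normr0.
  by rewrite (le_trans _ Rel) // oppr_le0 ltW.
case=> N1 _ N1P; exists (maxn 1 N1); first by rewrite leq_maxl.
move=> N; rewrite geq_max => /andP[_ N1N] lam nbij; rewrite ltNge; apply/negP => Relam.
apply: nbij; apply: spline_bijective => //; rewrite -/(D N lam).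
have [lK|lK] := boolP (`|lam| <= Om%:C).
  apply: (N1P N N1N); split; last exact: Im_le_norm.
  by rewrite Relam; have /andP[] := Re_le_norm lK.
(* Large frequencies: only the bound 1 on the Padé factors is used. *)
apply: large.
  by rewrite ltW // real_ltNge ?normr_real // gtr0_real // ltcR.
move=> k; rewrite /pade_factor normr_prod; apply: prodr_ile1 => j _.
rewrite normr_ge0 norm_pade_le1 //.
have g0 : 0 <= gap S j.
  have jm : (j < m.+1)%N by apply: leq_trans (ltn_ord k).
  by have -> : gap S j = gap S (Ordinal jm) by []; rewrite gapE subr_ge0 ltW // seg_lt.
by case: (lam) Relam => x y /= x0; rewrite mulr0 subr0 mulr_ge0.
Qed.
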